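(* Assume $m>1$. There exist $\varepsilon$ with $0<\varepsilon\le\frac{1}{m-1}$ and $C>0$, both depending only on $\phi$, such that for all $x\in\mathbb{R}^n$ \[ \|\nabla\phi(x)\|^{1+\varepsilon}\,\|x\|^{1-(m-1)\varepsilon}\ \ge\ C\,\phi(x). \]
   Context: Let $n\ge 1$ and let $\phi\in\mathbb{R}[x_1,\dots,x_n]$ be a homogeneous polynomial of degree $m$ with $\phi(x)\ge 0$ for all $x\in\mathbb{R}^n$. $\|\cdot\|$ is the Euclidean norm and $\nabla\phi$ the Euclidean gradient. (The convention $0^0=1$ is used if $1-(m-1)\varepsilon=0$.) *)

(* Defs.v *)
From Stdlib Require Import Reals List.
Import ListNotations.
Open Scope R_scope.

(* Points of R^n are functions nat -> R; only coordinates 0..n-1 matter. *)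

Definition sumR (n : nat) (f : nat -> R) : R :=
  fold_right Rplus 0 (map f (seq 0 n)).

Definition norm (n : nat) (x : nat -> R) : R :=
  sqrt (sumR n (fun i => x i ^ 2)).

(* A polynomial in variables x_0..x_{n-1} with real coefficients, given as a
   finite list of terms (c, e) meaning c * x_0^(e_0) * ... * x_{k-1}^(e_{k-1}),
   where k = length e. *)
Definition monomial := (R * list nat)%type.
Definition rpoly := list monomial.

Fixpoint mono_eval_aux (i : nat) (e : list nat) (x : nat -> R) : R :=
  match e with
  | [] => 1
  | a :: e' => x i ^ a * mono_eval_aux (S i) e' x
  end.

Definition poly_eval (p : rpoly) (x : nat -> R) : R :=
  fold_right Rplus 0 (map (fun t => fst t * mono_eval_aux 0 (snd t) x) p).

Definition homogeneous_poly (n m : nat) (p : rpoly) : Prop :=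
  Forall (fun t => length (snd t) = n /\ fold_right plus 0%nat (snd t) = m) p.

Definition upd (x : nat -> R) (j : nat) (t : R) : nat -> R :=
  fun i => if Nat.eqb i j then t else x i.

Definition is_gradient (n : nat) (f : (nat -> R) -> R) (x g : nat -> R) : Prop :=
  forall j, (j < n)%nat -> derivable_pt_lim (fun t => f (upd x j t)) (x j) (g j).

(* real power a^b for a >= 0, with 0^0 = 1 and 0^b = 0 for b <> 0 *)
Definition rpow (a b : R) : R :=
  if Req_EM_T a 0 then (if Req_EM_T b 0 then 1 else 0) else Rpower a b.

(* Main.v *)
(* On the unit sphere the claim is a Lojasiewicz gradient inequality
   [phi ^ (1 - 1/(2N)) <= const * |grad phi|] where [phi] is small; elsewhere Euler's
   identity bounds [|grad phi|] from below, and homogeneity gives all [x], with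
   [eps = 1/(2N - 1)].

   Instead of curve selection and Puiseux series, only quantifier elimination over the
   reals is used: a semialgebraic relation between [s] and [t] is constant on a cusp
   [0 < s < d, 0 < t < s ^ N].  Definable choice yields an arc [X t] on the sphere with
   [phi (X t) = t] along which [|grad phi|] is almost minimal on the level set.  The cusp
   property makes its coordinates monotone in small steps, and makes its length on
   [[t, 2t]] at most a small power of [t].  As [phi] grows by [t] there, the gradient
   is at least [t] to a power smaller than 1. *)
Require Import Defs.
From mathcomp Require all_boot all_algebra ordered_qelim qe_rcf Rstruct.
From Stdlib Require Import Reals List Lra Lia Psatz Classical ClassicalEpsilon.
From Stdlib Require Import FunctionalExtensionality PropExtensionality.
Open Scope R_scope.

(** Definable choice gives no continuity and none is proved: the arc may jump. This is why its
    length is measured on finitely many points: a jump merely counts towards the total variation,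
    which telescopes by monotonicity, and the gradient is estimated at a single step that is no
    longer than the average. The number of steps is chosen after [t], large enough to bring every
    step inside the cusp and to absorb the second-order term.

    The cusp property is used in two opposite ways. For monotonicity, the base point is the large
    variable and the step the small one; for the length on [[t, 2t]], the size of the jump is the
    large variable and the base point the small one.

    An almost minimal gradient is asked for, so that no minimum has to be attained: Euler's identity
    makes the infimum on a level set positive, hence smaller than four times itself.

    Up to the last theorem the inequality keeps the form [c * F x ^ (2 * N - 1) <= gradsq n D x ^
    N], which is semialgebraic. The bound [m <= N] is imposed from the start, since it gives
    [1 / (2N - 1) <= 1 / (m - 1)]. *)

(** * Semialgebraic sets of real sequences *)

Definition env := nat -> R.

Definition scons (a : R) (e : env) : env :=
  fun i => match i with O => a | S j => e j end.

(** A predicate on functions instead of a syntax: with extensionality, any formula may be replaced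
    by an equivalent one, and quantified formulas are ordinary propositions. *)
Inductive polyfun : (env -> R) -> Prop :=
| pf_var i : polyfun (fun e => e i)
| pf_const c : polyfun (fun _ => c)
| pf_add F G : polyfun F -> polyfun G -> polyfun (fun e => F e + G e)
| pf_mul F G : polyfun F -> polyfun G -> polyfun (fun e => F e * G e).

Inductive semialg : (env -> Prop) -> Prop :=
| sa_pos F : polyfun F -> semialg (fun e => 0 < F e)
| sa_not A : semialg A -> semialg (fun e => ~ A e)
| sa_and A B : semialg A -> semialg B -> semialg (fun e => A e /\ B e).

Lemma pf_opp F : polyfun F -> polyfun (fun e => - F e).
Proof.
  intros HF. replace (fun e => - F e) with (fun e => (-1) * F e).
  - apply pf_mul; [apply pf_const | exact HF].
  - apply functional_extensionality; intros e; ring.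
Qed.

Lemma pf_sub F G : polyfun F -> polyfun G -> polyfun (fun e => F e - G e).
Proof. intros HF HG. apply pf_add; [exact HF | now apply pf_opp]. Qed.

Lemma pf_pow F k : polyfun F -> polyfun (fun e => F e ^ k).
Proof.
  intros HF; induction k as [|k IH]; simpl.
  - apply pf_const.
  - now apply pf_mul.
Qed.

Lemma pf_subst F (s : env -> env) :
  polyfun F -> (forall i, polyfun (fun e => s e i)) -> polyfun (fun e => F (s e)).
Proof.
  intros HF Hs; induction HF.
  - apply Hs.
  - apply pf_const.
  - now apply pf_add.
  - now apply pf_mul.
Qed.

Lemma sa_ext A B : (forall e, A e <-> B e) -> semialg A -> semialg B.
Proof.
  intros H HA. replace B with A; [exact HA|].
  apply functional_extensionality; intros e.
  apply propositional_extensionality; apply H.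
Qed.

Lemma sa_subst A (s : env -> env) :
  semialg A -> (forall i, polyfun (fun e => s e i)) -> semialg (fun e => A (s e)).
Proof.
  intros HA Hs; induction HA.
  - apply (sa_pos (fun e => F (s e))). now apply pf_subst.
  - now apply (sa_not (fun e => A (s e))).
  - now apply (sa_and (fun e => A (s e)) (fun e => B (s e))).
Qed.

Lemma sa_lt F G : polyfun F -> polyfun G -> semialg (fun e => F e < G e).
Proof.
  intros HF HG. apply (sa_ext (fun e => 0 < G e - F e)).
  - intros e; lra.
  - apply sa_pos. now apply pf_sub.
Qed.

Lemma sa_le F G : polyfun F -> polyfun G -> semialg (fun e => F e <= G e).
Proof.
  intros HF HG. apply (sa_ext (fun e => ~ G e < F e)).
  - intros e; lra.
  - apply sa_not. now apply sa_lt.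
Qed.

Lemma sa_eq F G : polyfun F -> polyfun G -> semialg (fun e => F e = G e).
Proof.
  intros HF HG. apply (sa_ext (fun e => F e <= G e /\ G e <= F e)).
  - intros e; lra.
  - apply sa_and; now apply sa_le.
Qed.

Lemma sa_or A B : semialg A -> semialg B -> semialg (fun e => A e \/ B e).
Proof.
  intros HA HB. apply (sa_ext (fun e => ~ (~ A e /\ ~ B e))).
  - intros e; tauto.
  - apply sa_not, sa_and; now apply sa_not.
Qed.

Lemma sa_imp A B : semialg A -> semialg B -> semialg (fun e => A e -> B e).
Proof.
  intros HA HB. apply (sa_ext (fun e => ~ (A e /\ ~ B e))).
  - intros e; tauto.
  - apply sa_not, sa_and; [|apply sa_not]; assumption.
Qed.

(** * Quantifier elimination over the reals *)

Module QuantifierElimination.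
Import all_boot all_algebra ordered_qelim qe_rcf Rstruct.

(** Library terms are evaluated in finite sequences. Allowing every prefix of length at least [M]
    lets two terms share a common prefix. *)
Lemma pf_term F : polyfun F -> exists (t : GRing.term R) (M : nat),
  GRing.rterm t /\ forall (e : env) K, (M <= K)%N -> GRing.eval (mkseq e K) t = F e.
Proof.
elim=> [i|c|G H _ [t [M [rt Ht]]] _ [u [N [ru Hu]]]|G H _ [t [M [rt Ht]]] _ [u [N [ru Hu]]]].
- by exists (GRing.Var R i), i.+1; split=> // e K iK; rewrite /= nth_mkseq.
- by exists (GRing.Const c), 0%N.
- exists (GRing.Add t u), (maxn M N); split=> [/=|e K]; first by rewrite rt.
  by rewrite geq_max => /andP[MK NK] /=; rewrite Ht // Hu.
- exists (GRing.Mul t u), (maxn M N); split=> [/=|e K]; first by rewrite rt.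
  by rewrite geq_max => /andP[MK NK] /=; rewrite Ht // Hu.
Qed.

Lemma sa_formula A : semialg A -> exists (f : ord.formula R) (M : nat),
  ord.rformula f /\ forall (e : env) K, (M <= K)%N -> ord.holds (mkseq e K) f <-> A e.
Proof.
elim=> [F /pf_term[t [M [rt Ht]]]|B _ [f [M [rf Hf]]]|
        B C _ [f [M [rf Hf]]] _ [g [N [rg Hg]]]].
- exists (ord.Lt (GRing.NatConst R 0) t), M; split=> [/=|e K MK] //=.
  rewrite Ht //; split=> H; first exact/RltP.
  exact/RltP.
- exists (ord.Not f), M; split=> // e K MK /=.
  by have := Hf e K MK; tauto.
- exists (ord.And f g), (maxn M N); split=> [/=|e K]; first by rewrite rf.
  rewrite geq_max => /andP[MK NK] /=.
  by have := Hf e K MK; have := Hg e K NK; tauto.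
Qed.

Section Interpretation.
Variables (s : nat -> env -> R) (K : nat).
Hypothesis pf_s : forall i, polyfun (s i).
Let sq (e : env) := mkseq (fun i => s i e) K.

(** The way back from syntax. The entries of the sequence are themselves polynomials in the
    environment, so that the slot of the eliminated variable can hold a constant. *)
Lemma term_pf (t : GRing.term R) :
  GRing.rterm t -> polyfun (fun e => GRing.eval (sq e) t).
Proof.
elim: t => //=.
- move=> i _; case: (ltnP i K) => iK.
    have -> : (fun e => (sq e)`_i)%R = s i; last exact: pf_s.
    by apply: functional_extensionality => e; rewrite nth_mkseq.
  have -> : (fun e => (sq e)`_i)%R = fun=> 0%R; last exact: pf_const.
  by apply: functional_extensionality => e; rewrite nth_default // size_mkseq.
- by move=> c _; apply: pf_const.
- by move=> c _; apply: pf_const.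
- by move=> t IHt u IHu /andP[/IHt pt /IHu pu]; apply: pf_add.
- by move=> t IHt /IHt pt; apply: pf_opp.
- move=> t IHt n /IHt pt; elim: n => [|n IHn]; first exact: pf_const.
  have -> : (fun e => GRing.eval (sq e) t *+ n.+1)%R =
            (fun e => GRing.eval (sq e) t + GRing.eval (sq e) t *+ n)%R.
    by apply: functional_extensionality => e; rewrite GRing.mulrS.
  exact: pf_add.
- by move=> t IHt u IHu /andP[/IHt pt /IHu pu]; apply: pf_mul.
- move=> t IHt n /IHt pt; elim: n => [|n IHn]; first exact: pf_const.
  have -> : (fun e => GRing.eval (sq e) t ^+ n.+1)%R =
            (fun e => GRing.eval (sq e) t * GRing.eval (sq e) t ^+ n)%R.
    by apply: functional_extensionality => e; rewrite GRing.exprS.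
  exact: pf_mul.
Qed.

Lemma formula_sa (f : ord.formula R) :
  ord.qf_form f -> ord.rformula f -> semialg (fun e => ord.holds (sq e) f).
Proof.
elim: f => //=.
- move=> b _ _; apply: (sa_ext (fun=> Rlt 0 (if b then 1 else 0))).
    by move=> _; case: b; split=> // H; lra.
  exact/sa_pos/pf_const.
- by move=> t u _ /andP[rt ru]; apply: sa_eq; apply: term_pf.
- move=> t u _ /andP[rt ru].
  apply: (sa_ext (fun e => Rlt (GRing.eval (sq e) t) (GRing.eval (sq e) u))).
    by move=> e; split=> H; apply/RltP.
  by apply: sa_lt; apply: term_pf.
- move=> t u _ /andP[rt ru].
  apply: (sa_ext (fun e => Rle (GRing.eval (sq e) t) (GRing.eval (sq e) u))).
    by move=> e; split=> H; apply/RleP.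
  by apply: sa_le; apply: term_pf.
- by move=> f IHf g IHg /andP[qf qg] /andP[rf rg]; apply: sa_and; auto.
- by move=> f IHf g IHg /andP[qf qg] /andP[rf rg]; apply: sa_or; auto.
- by move=> f IHf g IHg /andP[qf qg] /andP[rf rg]; apply: sa_imp; auto.
- by move=> f IHf qf rf; apply: sa_not; auto.
Qed.

End Interpretation.

Lemma sa_ex A : semialg A -> semialg (fun e => exists x, A (scons x e)).
Proof.
move=> /sa_formula[f [M [rf Hf]]].
pose g := ord.quantifier_elim (@wproj R) (ord.Exists 0 f).
have /andP[qg rg] : ord.qf_form g && ord.rformula g.
  exact: (ord.quantifier_elim_wf (@wf_QE_wproj R) (f := ord.Exists 0 f)).
have gP (e : seq R) : ord.holds e g <-> ord.holds e (ord.Exists 0 f).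
  have h := ord.quantifier_elim_rformP (@wf_QE_wproj R) (@valid_QE_wproj R)
    e (f := ord.Exists 0 f) rf.
  by split=> [/(ord.qf_evalP _ qg)/h|/h/(ord.qf_evalP _ qg)].
(* [Exists 0 f] overwrites entry 0, so any value may stand there; 0 is taken. *)
apply: (sa_ext (fun e => ord.holds (mkseq (fun i => scons 0%R e i) M.+1) g)).
  move=> e; rewrite gP /=; have upd0 x : (x :: map (scons 0%R e) (iota 1 M))%SEQ =
      mkseq (scons x e) M.+1.
    rewrite /mkseq /=; congr cons.
    by rewrite (iotaDl 1 0) -!map_comp.
  have HfS x := Hf (scons x e) M.+1 (leqnSn M).
  by split=> -[x Hx]; exists x; move: Hx; rewrite upd0 => /HfS.
apply: formula_sa => // -[|i] /=; first exact: pf_const.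
exact: pf_var.
Qed.

End QuantifierElimination.

(** The bound value and the environment are separate arguments here, so that unification applies the
    lemma directly to a quantified goal. *)
Lemma sa_ex (P : R -> env -> Prop) :
  semialg (fun e => P (e 0%nat) (fun i => e (S i))) ->
  semialg (fun e => exists x, P x e).
Proof. exact (QuantifierElimination.sa_ex _). Qed.

Lemma sa_all (P : R -> env -> Prop) :
  semialg (fun e => P (e 0%nat) (fun i => e (S i))) ->
  semialg (fun e => forall x, P x e).
Proof.
  intros H. apply (sa_ext (fun e => ~ exists x, ~ P x e)).
  - intros e; split; [|firstorder].
    intros Hn x; apply NNPP; intros Hx; apply Hn; now exists x.
  - apply sa_not, sa_ex. now apply sa_not in H.
Qed.

(** * Signs of polynomials in two variables on a cusp *)

Lemma Rabs_le_bounds a b : Rabs a <= b -> - b <= a <= b.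
Proof. intros H. pose proof (Rle_abs a). pose proof (Rle_abs (- a)). rewrite Rabs_Ropp in *. lra. Qed.

(** Horner form, lowest degree outermost: induction splits off the term that dominates near 0. In
    [poly2] the main variable is [t], the smaller one on a cusp. *)
Inductive poly1 : (R -> R) -> Prop :=
| p1_zero : poly1 (fun _ => 0)
| p1_cons c q : poly1 q -> poly1 (fun s => c + s * q s).

Inductive poly2 : (R -> R -> R) -> Prop :=
| p2_zero : poly2 (fun _ _ => 0)
| p2_cons p G : poly1 p -> poly2 G -> poly2 (fun s t => p s + t * G s t).

Lemma p1_ext p q : (forall s, p s = q s) -> poly1 p -> poly1 q.
Proof.
  intros H Hp. replace q with p; [exact Hp|].
  now apply functional_extensionality.
Qed.

Lemma p2_ext F G : (forall s t, F s t = G s t) -> poly2 F -> poly2 G.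
Proof.
  intros H HF. replace G with F; [exact HF|].
  apply functional_extensionality; intros s.
  now apply functional_extensionality.
Qed.

Lemma p1_add p q : poly1 p -> poly1 q -> poly1 (fun s => p s + q s).
Proof.
  intros Hp; revert q; induction Hp as [|c p Hp IH]; intros q Hq.
  - apply (p1_ext q); [intros; ring | exact Hq].
  - destruct Hq as [|d q Hq].
    + apply (p1_ext (fun s => c + s * p s)); [intros; ring | now constructor].
    + apply (p1_ext (fun s => (c + d) + s * (p s + q s))); [intros; ring|].
      apply p1_cons. now apply IH.
Qed.

Lemma p1_scal a p : poly1 p -> poly1 (fun s => a * p s).
Proof.
  intros Hp; induction Hp as [|c p Hp IH].
  - apply (p1_ext (fun _ => 0)); [intros; ring | constructor].
  - apply (p1_ext (fun s => a * c + s * (a * p s))); [intros; ring|].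
    now apply (p1_cons (a * c) (fun s => a * p s)).
Qed.

Lemma p1_mul p q : poly1 p -> poly1 q -> poly1 (fun s => p s * q s).
Proof.
  intros Hp Hq; induction Hp as [|c p Hp IH].
  - apply (p1_ext (fun _ => 0)); [intros; ring | constructor].
  - apply (p1_ext (fun s => c * q s + (0 + s * (p s * q s)))); [intros; ring|].
    apply p1_add; [now apply p1_scal|].
    now apply (p1_cons 0 (fun s => p s * q s)).
Qed.

Lemma p1_const c : poly1 (fun _ => c).
Proof.
  apply (p1_ext (fun s => c + s * 0)); [intros; ring|].
  apply (p1_cons c (fun _ => 0)); constructor.
Qed.

Lemma p2_add F G : poly2 F -> poly2 G -> poly2 (fun s t => F s t + G s t).
Proof.
  intros HF; revert G; induction HF as [|p F Hp HF IH]; intros G HG.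
  - apply (p2_ext G); [intros; ring | exact HG].
  - destruct HG as [|q G Hq HG].
    + apply (p2_ext (fun s t => p s + t * F s t)); [intros; ring | now constructor].
    + apply (p2_ext (fun s t => (p s + q s) + t * (F s t + G s t))); [intros; ring|].
      apply (p2_cons (fun s => p s + q s)); [now apply p1_add | now apply IH].
Qed.

Lemma p2_scal p F : poly1 p -> poly2 F -> poly2 (fun s t => p s * F s t).
Proof.
  intros Hp HF; induction HF as [|q F Hq HF IH].
  - apply (p2_ext (fun _ _ => 0)); [intros; ring | constructor].
  - apply (p2_ext (fun s t => p s * q s + t * (p s * F s t))); [intros; ring|].
    apply (p2_cons (fun s => p s * q s)); [now apply p1_mul | exact IH].
Qed.

Lemma p2_mul F G : poly2 F -> poly2 G -> poly2 (fun s t => F s t * G s t).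
Proof.
  intros HF HG; induction HF as [|p F Hp HF IH].
  - apply (p2_ext (fun _ _ => 0)); [intros; ring | constructor].
  - apply (p2_ext (fun s t => p s * G s t + (0 + t * (F s t * G s t)))); [intros; ring|].
    apply p2_add; [now apply p2_scal|].
    apply (p2_cons (fun _ => 0)); [constructor | exact IH].
Qed.

Definition env0 : env := fun _ => 0.

Lemma polyfun_poly2 F : polyfun F -> poly2 (fun s t => F (scons s (scons t env0))).
Proof.
  intros HF; induction HF.
  - destruct i as [|[|i]]; simpl.
    + apply (p2_ext (fun s t => (0 + s * 1) + t * 0)); [intros; ring|].
      apply (p2_cons (fun s => 0 + s * 1)); [|constructor].
      apply (p1_cons 0 (fun _ => 1)), p1_const.
    + apply (p2_ext (fun s t => 0 + t * (1 + t * 0))); [intros; ring|].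
      apply (p2_cons (fun _ => 0)); [constructor|].
      apply (p2_cons (fun _ => 1)); [apply p1_const | constructor].
    + constructor.
  - apply (p2_ext (fun s t => c + t * 0)); [intros; ring|].
    apply (p2_cons (fun _ => c)); [apply p1_const | constructor].
  - now apply p2_add.
  - now apply p2_mul.
Qed.

Lemma poly1_bounded p :
  poly1 p -> exists B, 0 < B /\ forall s, 0 < s < 1 -> Rabs (p s) <= B.
Proof.
  intros Hp; induction Hp as [|c q Hq [B [HB IH]]].
  - exists 1; split; [lra|]. intros; rewrite Rabs_R0; lra.
  - exists (Rabs c + B); pose proof (Rabs_pos c); split; [lra|].
    intros s Hs. eapply Rle_trans; [apply Rabs_triang|].
    rewrite Rabs_mult, (Rabs_right s) by lra.
    specialize (IH s Hs). pose proof (Rabs_pos (q s)). nra.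
Qed.

Lemma poly2_bounded F : poly2 F ->
  exists B, 0 < B /\ forall s t, 0 < s < 1 -> 0 < t < 1 -> Rabs (F s t) <= B.
Proof.
  intros HF; induction HF as [|p G Hp HG [B [HB IH]]].
  - exists 1; split; [lra|]. intros; rewrite Rabs_R0; lra.
  - destruct (poly1_bounded p Hp) as [A [HA Hpb]].
    exists (A + B); split; [lra|].
    intros s t Hs Ht. eapply Rle_trans; [apply Rabs_triang|].
    rewrite Rabs_mult, (Rabs_right t) by lra.
    specialize (IH s t Hs Ht). specialize (Hpb s Hs).
    pose proof (Rabs_pos (G s t)). nra.
Qed.

(** The lowest nonzero coefficient decides. The bound by [s ^ k], stronger than a sign, leaves room
    for the terms in [t] of a polynomial in two variables. *)
Lemma poly1_sign p : poly1 p ->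
  exists (k : nat) d, 0 < d < 1 /\
    ((forall s, 0 < s < d -> s ^ k < p s) \/
     (forall s, 0 < s < d -> p s < - s ^ k) \/
     (forall s, p s = 0)).
Proof.
  intros Hp; induction Hp as [|c q Hq IH].
  - exists 0%nat, (1/2); split; [lra|]. right; right; reflexivity.
  - destruct (Req_dec c 0) as [->|Hc].
    + destruct IH as [k [d [Hd [H|[H|H]]]]]; exists (S k), d; split; try exact Hd.
      * left; intros s Hs; specialize (H s Hs); simpl; nra.
      * right; left; intros s Hs; specialize (H s Hs); simpl; nra.
      * right; right; intros s; rewrite H; ring.
    + destruct (poly1_bounded q Hq) as [B [HB Hb]].
      assert (Hc' : 0 < Rabs c) by now apply Rabs_pos_lt.
      (* For [s < d], [s * B + s < Rabs c]; so [c] outweighs [s * q s] by more than [s], and [k = 1]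
         works. *)
      set (d := Rmin (1/2) (Rabs c / (1 + B))).
      assert (Hd : 0 < d).
      { unfold d; apply Rmin_glb_lt; [lra | apply Rdiv_lt_0_compat; lra]. }
      assert (Hd1 : d <= 1/2) by apply Rmin_l.
      assert (Hd2 : d <= Rabs c / (1 + B)) by apply Rmin_r.
      assert (Hd3 : d * (1 + B) <= Rabs c).
      { apply Rmult_le_reg_r with (/ (1 + B)); [apply Rinv_0_lt_compat; lra|].
        rewrite Rmult_assoc, Rinv_r by lra. unfold Rdiv in Hd2; lra. }
      exists 1%nat, d; split; [lra|].
      assert (Hq' : forall s, 0 < s < d -> - B <= q s <= B /\ s * (1 + B) < Rabs c).
      { intros s Hs. assert (Hb' := Hb s ltac:(lra)).
        apply Rabs_le_bounds in Hb'. split; [lra | nra]. }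
      destruct (Rcase_abs c) as [Hn|Hn].
      * right; left; intros s Hs; destruct (Hq' s Hs) as [H1 H2].
        rewrite Rabs_left in H2 by lra. rewrite pow_1. nra.
      * left; intros s Hs; destruct (Hq' s Hs) as [H1 H2].
        rewrite Rabs_right in H2 by lra. rewrite pow_1. nra.
Qed.

Definition in_cusp (N : nat) (d s t : R) : Prop := 0 < s < d /\ 0 < t < s ^ N.

Lemma pow_lt_1 s k : 0 < s < 1 -> 0 < s ^ k <= 1.
Proof.
  intros Hs; split; [apply pow_lt; lra|].
  rewrite <- (pow1 k). apply pow_incr; lra.
Qed.

Lemma pow_antitone s j k : 0 < s < 1 -> (j <= k)%nat -> s ^ k <= s ^ j.
Proof.
  intros Hs Hjk. replace k with (j + (k - j))%nat by lia. rewrite pow_add.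
  pose proof (pow_lt_1 s j Hs). pose proof (pow_lt_1 s (k - j) Hs). nra.
Qed.

Lemma in_cusp_shrink N M d d' s t :
  (N <= M)%nat -> 0 < d' <= d -> d' <= 1 -> in_cusp M d' s t -> in_cusp N d s t.
Proof.
  intros HNM Hd Hd1 [Hs Ht]. split; [lra|].
  pose proof (pow_antitone s N M ltac:(lra) HNM). lra.
Qed.

(* Where [t < s ^ N], the polynomial is dominated by the lowest power of [t]. *)
Lemma poly2_sign F : poly2 F ->
  exists (N : nat) d, 0 < d < 1 /\
    ((forall s t, in_cusp N d s t -> 0 < F s t) \/
     (forall s t, in_cusp N d s t -> F s t <= 0)).
Proof.
  assert (sign3 : poly2 F -> exists (N : nat) d, 0 < d < 1 /\
    ((forall s t, in_cusp N d s t -> 0 < F s t) \/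
     (forall s t, in_cusp N d s t -> F s t < 0) \/ (forall s t, F s t = 0))).
  { intros HF; induction HF as [|p G Hp HG IH].
    - exists 0%nat, (1/2); split; [lra|]. right; right; reflexivity.
    - destruct (poly1_sign p Hp) as [k [d1 [Hd1 Hsign]]].
      assert (Hzero : (forall s, p s = 0) \/ ~ (forall s, p s = 0)) by apply classic.
      destruct Hzero as [Hz|Hz].
      + destruct IH as [N [d [Hd [H|[H|H]]]]]; exists N, d; split; try exact Hd.
        * left; intros s t Hst; specialize (H s t Hst); destruct Hst.
          rewrite Hz; nra.
        * right; left; intros s t Hst; specialize (H s t Hst); destruct Hst.
          rewrite Hz; nra.
        * right; right; intros s t; rewrite H, Hz; ring.
      + destruct (poly2_bounded G HG) as [B [HB Hb]].
        (* With [t < s ^ (k + 1)] and [s * B <= 1], the remainder [t * G s t] is at most [s ^ k],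
           which [p s] exceeds in absolute value. *)
        set (d := Rmin d1 (/ (1 + B))).
        assert (HB' : 0 < / (1 + B)) by (apply Rinv_0_lt_compat; lra).
        assert (Hd : 0 < d) by (unfold d; apply Rmin_glb_lt; lra).
        assert (Hdd1 : d <= d1) by apply Rmin_l.
        assert (Hdd2 : d <= / (1 + B)) by apply Rmin_r.
        assert (Hd3 : d * (1 + B) <= 1).
        { apply Rmult_le_reg_r with (/ (1 + B)); [exact HB'|].
          rewrite Rmult_assoc, Rinv_r by lra. lra. }
        assert (key : forall s t, in_cusp (S k) d s t -> Rabs (t * G s t) <= s ^ k).
        { intros s t [Hs Ht].
          pose proof (pow_lt_1 s k ltac:(lra)). pose proof (pow_lt_1 s (S k) ltac:(lra)).
          rewrite Rabs_mult, Rabs_right by lra.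
          specialize (Hb s t ltac:(lra) ltac:(lra)). simpl in Ht.
          apply Rle_trans with (t * B); [apply Rmult_le_compat_l; lra|].
          apply Rle_trans with (s * s ^ k * B); [apply Rmult_le_compat_r; lra|].
          assert (s * B <= 1) by nra. nra. }
        exists (S k), d; split; [lra|].
        destruct Hsign as [H|[H|H]]; [left|right; left|contradiction];
          intros s t Hst; specialize (key s t Hst); apply Rabs_le_bounds in key;
          destruct Hst as [Hs _]; specialize (H s ltac:(lra)); lra. }
  intros HF; destruct (sign3 HF) as [N [d [Hd [H|[H|H]]]]]; exists N, d; split; auto.
  - right; intros s t Hst; specialize (H s t Hst); lra.
  - right; intros s t _; rewrite H; lra.
Qed.

(** Since quantifiers are already eliminated, induction on the formula reduces to signs of
    polynomials. Two cusps are intersected by taking the larger exponent and the smaller width. *)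
Lemma semialg_cusp A : semialg A ->
  exists (N : nat) d, 0 < d < 1 /\
    ((forall s t, in_cusp N d s t -> A (scons s (scons t env0))) \/
     (forall s t, in_cusp N d s t -> ~ A (scons s (scons t env0)))).
Proof.
  intros HA; induction HA as [F HF|A HA [N [d [Hd IH]]]|
    A B HA [N [d [Hd IHA]]] HB [M [d' [Hd' IHB]]]].
  - destruct (poly2_sign _ (polyfun_poly2 F HF)) as [N [d [Hd [H|H]]]];
      exists N, d; split; auto.
    right; intros s t Hst. specialize (H s t Hst); simpl in H; lra.
  - exists N, d; split; [exact Hd|]. destruct IH as [H|H]; [right|left]; auto.
  - assert (Hm : 0 < Rmin d d') by (apply Rmin_glb_lt; lra).
    pose proof (Rmin_l d d'); pose proof (Rmin_r d d').
    exists (Nat.max N M), (Rmin d d'); split; [lra|].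
    assert (HN : forall s t, in_cusp (Nat.max N M) (Rmin d d') s t -> in_cusp N d s t)
      by (intros s t; apply in_cusp_shrink; try lra; lia).
    assert (HM : forall s t, in_cusp (Nat.max N M) (Rmin d d') s t -> in_cusp M d' s t)
      by (intros s t; apply in_cusp_shrink; try lra; lia).
    destruct IHA as [H1|H1]; [|right; intros s t Hst [Ha _]; now apply (H1 s t (HN s t Hst))].
    destruct IHB as [H2|H2]; [|right; intros s t Hst [_ Hb]; now apply (H2 s t (HM s t Hst))].
    left; intros s t Hst; split; auto.
Qed.

(** The cusp property for a relation that ignores [t]; [s ^ N / 2] serves as a second coordinate
    inside the cusp. *)
Lemma semialg_germ A : semialg A ->
  exists d, 0 < d < 1 /\
    ((forall s, 0 < s < d -> A (scons s env0)) \/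
     (forall s, 0 < s < d -> ~ A (scons s env0))).
Proof.
  intros HA.
  destruct (semialg_cusp (fun e => A (scons (e 0%nat) env0))) as [N [d [Hd H]]].
  { apply (sa_subst A (fun e => scons (e 0%nat) env0) HA).
    intros [|i]; simpl; constructor. }
  exists d; split; [exact Hd|].
  assert (Hin : forall s, 0 < s < d -> in_cusp N d s (s ^ N / 2)).
  { intros s Hs; split; [exact Hs|]. pose proof (pow_lt_1 s N ltac:(lra)); lra. }
  destruct H as [H|H]; [left|right]; intros s Hs; exact (H s _ (Hin s Hs)).
Qed.

(** * Semialgebraic functions and definable choice on the line *)

Definition shift (e : env) : env := fun i => e (S i).

Lemma sa_apply (B : R -> env -> Prop) F (s : env -> env) :
  semialg (fun e => B (e 0%nat) (shift e)) -> polyfun F ->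
  (forall i, polyfun (fun e => s e i)) -> semialg (fun e => B (F e) (s e)).
Proof.
  intros HB HF Hs.
  apply (sa_subst (fun e => B (e 0%nat) (shift e)) (fun e => scons (F e) (s e)) HB).
  intros [|i]; simpl; [exact HF | apply Hs].
Qed.

Ltac poly := unfold Rdiv, Rminus; repeat first
  [ apply pf_var | apply pf_const | apply pf_add | apply pf_mul | apply pf_opp ].

Ltac semialg_step := cbv beta; unfold shift; cbv beta;
  first [ apply sa_and | apply sa_or | apply sa_not | apply sa_imp | apply sa_ex
        | apply sa_all | apply sa_eq; poly; fail | apply sa_le; poly; fail
        | apply sa_lt; poly; fail ].

Definition sa_fun (f : env -> R) : Prop := semialg (fun e => e 0%nat = f (shift e)).

(** Only the graph of [f] is known to be semialgebraic, so the substitution costs one existential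
    quantifier over the value. *)
Lemma sa_fun_subst A f :
  semialg A -> sa_fun f -> semialg (fun e => A (scons (f e) e)).
Proof.
  intros HA Hf. apply (sa_ext (fun e => exists v, v = f e /\ A (scons v e))).
  - intros e; split; [now intros [v [-> H]] | intros H; now exists (f e)].
  - apply sa_ex, sa_and; [exact Hf|].
    apply (sa_apply (fun v e => A (scons v e))).
    + apply (sa_subst A (fun e => scons (e 0%nat) (shift e)) HA).
      intros [|i]; apply pf_var.
    + apply pf_var.
    + intros i; apply pf_var.
Qed.

Lemma sa_fun_comp f (s : env -> env) :
  sa_fun f -> (forall i, polyfun (fun e => s e i)) -> sa_fun (fun e => f (s e)).
Proof.
  intros Hf Hs.
  apply (sa_apply (fun v e => v = f e) (fun e => e 0%nat) (fun e => s (shift e)) Hf).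
  - apply pf_var.
  - intros i. apply (pf_subst (fun e => s e i) shift (Hs i)). intros j; apply pf_var.
Qed.

Lemma sa_fun_const c : sa_fun (fun _ => c).
Proof. apply sa_eq; poly. Qed.

(** Definable description: [epsilon] picks the value, and by uniqueness its graph is [D] itself,
    completed by the value 0 where [D] has no solution. *)
Lemma sa_of_unique (D : R -> env -> Prop) :
  semialg (fun e => D (e 0%nat) (shift e)) ->
  (forall e v w, D v e -> D w e -> v = w) ->
  exists f, sa_fun f /\ forall e, (exists v, D v e) -> D (f e) e.
Proof.
  intros HD Huniq.
  set (D' := fun v e => D v e \/ ((~ exists w, D w e) /\ v = 0)).
  assert (HD' : semialg (fun e => D' (e 0%nat) (shift e))).
  { unfold D'. apply sa_or; [exact HD|]. apply sa_and; [|apply sa_eq; poly].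
    apply sa_not, sa_ex. cbv beta.
    apply (sa_apply D (fun e => e 0%nat) (fun e i => e (S (S i))) HD); intros; apply pf_var. }
  assert (Hex : forall e, exists v, D' v e).
  { intros e. destruct (classic (exists w, D w e)) as [[w Hw]|Hn].
    - exists w; now left.
    - exists 0; now right. }
  exists (fun e => epsilon (inhabits 0) (fun v => D' v e)).
  assert (Heps : forall e, D' (epsilon (inhabits 0) (fun v => D' v e)) e)
    by (intros e; apply epsilon_spec, Hex).
  assert (Huniq' : forall e v w, D' v e -> D' w e -> v = w).
  { intros e v w [Hv|[Hv ->]] [Hw|[Hw ->]].
    - now apply (Huniq e).
    - exfalso; apply Hw; now exists v.
    - exfalso; apply Hv; now exists w.
    - reflexivity. }
  split.
  - apply (sa_ext (fun e => D' (e 0%nat) (shift e))); [|exact HD'].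
    intros e; split; intros H.
    + now apply (Huniq' (shift e)).
    + rewrite H. apply Heps.
  - intros e [v Hv]. destruct (Heps e) as [H|[H _]]; [exact H|].
    exfalso; apply H; now exists v.
Qed.

Lemma inf_exists (P : R -> Prop) m : (exists v, P v) -> (forall v, P v -> m <= v) ->
  exists a, (forall v, P v -> a <= v) /\ (forall b, (forall v, P v -> b <= v) -> b <= a).
Proof.
  intros [v Hv] Hm.
  destruct (completeness (fun x => P (- x))) as [s [Hub Hlub]].
  - exists (- m). intros x Hx. specialize (Hm _ Hx). lra.
  - exists (- v). now rewrite Ropp_involutive.
  - exists (- s); split.
    + intros w Hw. assert (- w <= s); [|lra].
      apply Hub. now rewrite Ropp_involutive.
    + intros b Hb. assert (s <= - b); [|lra].
      apply Hlub. intros x Hx. specialize (Hb _ Hx). lra.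
Qed.

(* The chosen point is the minimum if there is one; otherwise the set starts with
   an open interval, and the midpoint of the longest such interval is chosen. *)
Lemma sa_choice A : semialg A -> exists f, sa_fun f /\
  forall e, (exists v, -1 <= v <= 1 /\ A (scons v e)) ->
    -1 <= f e <= 1 /\ A (scons (f e) e).
Proof.
  intros HA.
  (* The restriction to [[-1, 1]], enough for points of the sphere, keeps the infimum and the
     interval lengths finite. *)
  set (B := fun v e => -1 <= v <= 1 /\ A (scons v e)).
  assert (HB : semialg (fun e => B (e 0%nat) (shift e))).
  { unfold B. repeat semialg_step. apply (sa_subst A (fun e => scons (e 0%nat) (shift e)) HA).
    intros [|i]; apply pf_var. }
  set (inf := fun a e => (forall v, B v e -> a <= v) /\
    forall b, (forall v, B v e -> b <= v) -> b <= a).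
  set (gap := fun a c e => forall y, a < y /\ y < c -> B y e).
  (* In the second alternative, [a] is the infimum, not attained, [b] is the supremum of the right
     ends of intervals from [a] inside [B], and [v] is their midpoint. *)
  set (C := fun v e => (B v e /\ inf v e) \/
    exists a, inf a e /\ ~ B a e /\ exists b,
      ((forall c, gap a c e -> c <= b) /\
       forall b', (forall c, gap a c e -> c <= b') -> b <= b') /\ v + v = a + b).
  assert (HC : semialg (fun e => C (e 0%nat) (shift e))).
  { unfold C, inf, gap. clearbody B.
    repeat first [ semialg_step
                 | cbv beta; apply (sa_apply B _ _ HB); [apply pf_var | intros; apply pf_var] ]. }
  destruct (sa_of_unique C HC) as [f [Hf Hspec]].
  { assert (Hinf : forall e a a', inf a e -> inf a' e -> a = a').
    { intros e a a' [H1 H2] [H3 H4]. apply Rle_antisym; auto. }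
    intros e v w [[Hv Hv']|[a [Ha [Hna [b [[Hb Hb'] Hv]]]]]]
      [[Hw Hw']|[a' [Ha' [Hna' [b' [[Hc Hc'] Hw]]]]]].
    - now apply (Hinf e).
    - exfalso. rewrite (Hinf e a' v Ha' Hv') in Hna'. contradiction.
    - exfalso. rewrite (Hinf e a w Ha Hw') in Hna. contradiction.
    - rewrite (Hinf e a' a Ha' Ha) in *. assert (b = b') by (apply Rle_antisym; auto). lra. }
  exists f; split; [exact Hf|].
  intros e He. change (B (f e) e).
  assert (Hex : exists v, C v e /\ B v e).
  { destruct (inf_exists (fun v => B v e) (-1) He) as [a Ha].
    { intros v [Hv _]; lra. }
    destruct (classic (B a e)) as [HBa|HnBa].
    { exists a; split; [left; split|]; assumption. }
    (* Just to the right of [a], the set contains a whole interval or misses one; missing one would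
       make [a + d] a lower bound. *)
    destruct (semialg_germ (fun e' => B (a + e' 0%nat) e)) as [d [Hd [H|H]]].
    { apply (sa_apply B (fun e' => a + e' 0%nat) (fun _ => e) HB); [poly | intros; poly]. }
    - simpl in H.
      assert (Hgap : gap a (a + d) e).
      { intros y Hy. replace y with (a + (y - a)) by ring. apply H; lra. }
      assert (Ha1 : a <= 1).
      { destruct He as [v [Hv1 Hv2]]. destruct Ha as [Ha _].
        specialize (Ha v (conj Hv1 Hv2)). lra. }
      (* An interval reaching beyond 1 would contain a point outside [[-1, 1]], so the right ends
         are bounded. *)
      destruct (completeness (fun c => gap a c e)) as [b [Hub Hlub]].
      + exists 1. intros c Hc. apply Rnot_lt_le; intros Hc1.
        destruct (Hc ((1 + c) / 2)) as [Hy _]; lra.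
      + now exists (a + d).
      + assert (Hb : a + d <= b) by now apply Hub.
        assert (Hmid : exists c, gap a c e /\ (a + b) / 2 < c).
        { apply NNPP; intros Hn. assert (b <= (a + b) / 2); [|lra].
          apply Hlub. intros c Hc. apply Rnot_lt_le; intros Hlt. apply Hn; now exists c. }
        destruct Hmid as [c [Hc Hlt]].
        exists ((a + b) / 2); split; [|apply Hc; lra].
        right; exists a; split; [exact Ha|]; split; [exact HnBa|].
        exists b; split; [|field]. split; [exact Hub | exact Hlub].
    - exfalso. simpl in H. destruct Ha as [Ha1 Ha2].
      assert (a + d <= a); [|lra]. apply Ha2. intros v Hv. specialize (Ha1 v Hv).
      apply Rnot_lt_le; intros Hlt.
      destruct (Req_dec v a) as [->|Hva]; [contradiction|].
      apply (H (v - a)); [lra|]. now replace (a + (v - a)) with v by ring. }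
  destruct Hex as [v [Hv HBv]].
  destruct (Hspec e (ex_intro _ v Hv)) as [[H _]|[a [Ha [Hna [b [[Hb Hb'] Hf2]]]]]]; [exact H|].
  destruct Hv as [[_ Hinf]|[a' [Ha' [_ [b' [[Hc Hc'] Hw]]]]]].
  - exfalso; apply Hna. replace a with v; [exact HBv|].
    destruct Ha, Hinf; apply Rle_antisym; auto.
  - assert (a = a') by (destruct Ha, Ha'; apply Rle_antisym; auto). subst a'.
    assert (b = b') by (apply Rle_antisym; auto).
    replace (f e) with v by lra. exact HBv.
Qed.

(** * Quantification and choice over vectors *)

(** Binds [n] variables at once, for a variable [n]. The outer environment moves to the indices from
    [n] on; in the applications its first entry is a level [t], read at index [n]. *)
Definition join (n : nat) (y : nat -> R) (e : env) : env :=
  fun i => if Nat.ltb i n then y i else e (i - n)%nat.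

Lemma join_lt n y e i : (i < n)%nat -> join n y e i = y i.
Proof. intros H. unfold join. apply Nat.ltb_lt in H. now rewrite H. Qed.

Lemma join_ge n y e i : join n y e (n + i)%nat = e i.
Proof.
  unfold join. replace (Nat.ltb (n + i) n) with false by (symmetry; apply Nat.ltb_ge; lia).
  f_equal; lia.
Qed.

Lemma join_0 y e : join 0 y e = e.
Proof. apply functional_extensionality; intros i. apply (join_ge 0 y e i). Qed.

(** The last coordinate is peeled off as the outermost bound variable, which is what the inductions
    on [n] use. *)
Lemma join_S n y e : join (S n) y e = join n y (scons (y n) e).
Proof.
  apply functional_extensionality; intros i.
  destruct (Nat.lt_ge_cases i n) as [H|H].
  - now rewrite !join_lt by lia.
  - destruct (Nat.eq_dec i n) as [->|Hn].
    + rewrite join_lt by lia. pose proof (join_ge n y (scons (y n) e) 0) as H0.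
      now rewrite Nat.add_0_r in H0.
    + replace i with (S n + (i - S n))%nat by lia. rewrite join_ge.
      replace (S n + (i - S n))%nat with (n + S (i - S n))%nat by lia. now rewrite join_ge.
Qed.

Lemma join_agree n y z e : (forall i, (i < n)%nat -> y i = z i) -> join n y e = join n z e.
Proof.
  intros H. apply functional_extensionality; intros i.
  destruct (Nat.lt_ge_cases i n) as [Hi|Hi].
  - rewrite !join_lt by lia. now apply H.
  - replace i with (n + (i - n))%nat by lia. now rewrite !join_ge.
Qed.

Lemma sa_ex_vec n A : semialg A -> semialg (fun e => exists y, A (join n y e)).
Proof.
  intros HA; induction n as [|n IH].
  - apply (sa_ext A); [|exact HA]. intros e; split.
    + intros H; exists (fun _ => 0); now rewrite join_0.
    + intros [y H]; now rewrite join_0 in H.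
  - apply (sa_ext (fun e => exists v, exists y, A (join n y (scons v e)))).
    + intros e; split.
      * intros [v [y H]]. exists (fun i => if Nat.eqb i n then v else y i).
        rewrite join_S, Nat.eqb_refl.
        rewrite (join_agree n _ y); [exact H|].
        intros i Hi. replace (Nat.eqb i n) with false; [reflexivity|].
        symmetry; apply Nat.eqb_neq; lia.
      * intros [y H]. rewrite join_S in H. now exists (y n), y.
    + apply sa_ex. cbv beta.
      apply (sa_subst _ (fun e => scons (e 0%nat) (fun i => e (S i))) IH).
      intros [|i]; apply pf_var.
Qed.

Lemma sa_all_vec n A : semialg A -> semialg (fun e => forall y, A (join n y e)).
Proof.
  intros HA. apply (sa_ext (fun e => ~ exists y, ~ A (join n y e))).
  - intros e; split; [|firstorder].
    intros Hn y; apply NNPP; intros Hy; apply Hn; now exists y.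
  - apply sa_not, (sa_ex_vec n (fun e => ~ A e)). now apply sa_not.
Qed.

Lemma sa_fun_subst_vec n A (X : nat -> env -> R) :
  semialg A -> (forall i, sa_fun (X i)) ->
  semialg (fun e => A (join n (fun i => X i e) e)).
Proof.
  intros HA; revert X; induction n as [|n IH]; intros X HX.
  - apply (sa_ext A); [|exact HA]. intros e; now rewrite join_0.
  (* [shift] recovers the original environment, on which the remaining components depend, from the
     extended one. *)
  - apply (sa_ext (fun e => A (join n (fun i => X i (shift (scons (X n e) e))) (scons (X n e) e)))).
    + intros e; now rewrite join_S.
    + apply (sa_fun_subst (fun e => A (join n (fun i => X i (shift e)) e))); [|apply HX].
      apply (IH (fun i e => X i (shift e))). intros i.
      apply sa_fun_comp; [apply HX | intros; apply pf_var].
Qed.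

Definition box (n : nat) (y : nat -> R) : Prop := forall i, (i < n)%nat -> -1 <= y i <= 1.

Lemma sa_box n : semialg (box n).
Proof.
  induction n as [|n IH].
  - apply (sa_ext (fun _ => 0 < 1)); [|apply sa_pos; poly].
    intros e; split; [intros _ i Hi; lia | intros; lra].
  - apply (sa_ext (fun e => box n e /\ (-1 <= e n /\ e n <= 1))).
    + intros e; split.
      * intros [H Hn] i Hi. destruct (Nat.eq_dec i n) as [->|]; [lra | apply H; lia].
      * intros H; split; [intros i Hi; apply H; lia | apply H; lia].
    + apply sa_and; [exact IH|]. apply sa_and; apply sa_le; poly.
Qed.

Lemma box_join n y e : box n (join n y e) <-> box n y.
Proof.
  split; intros H i Hi; specialize (H i Hi); now rewrite join_lt in *.
Qed.

(** The last coordinate is chosen in the projection of the set; the others come from the induction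
    hypothesis, in the environment extended by that choice. *)
Lemma sa_choice_vec n A : semialg A -> exists X : nat -> env -> R,
  (forall i, sa_fun (X i)) /\
  forall e, (exists y, box n y /\ A (join n y e)) ->
    box n (fun i => X i e) /\ A (join n (fun i => X i e) e).
Proof.
  intros HA; induction n as [|n [X [HX Hspec]]].
  - exists (fun _ _ => 0); split; [intros; apply sa_fun_const|].
    intros e [y [_ H]]; split; [intros i Hi; lia|]. now rewrite join_0 in *.
  - destruct (sa_choice (fun e => exists y, box n y /\ A (join n y e))) as [f [Hf Hfspec]].
    { apply (sa_ext (fun e => exists y, (fun e' => box n e' /\ A e') (join n y e))).
      - intros e; split; intros [y [H1 H2]]; exists y; (split; [|exact H2]);
          now apply box_join in H1 || apply box_join.
      - apply (sa_ex_vec n (fun e' => box n e' /\ A e')).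
        apply sa_and; [apply sa_box | exact HA]. }
    exists (fun i e => if Nat.eqb i n then f e else X i (scons (f e) e)); split.
    + intros i. destruct (Nat.eqb i n); [exact Hf|].
      apply (sa_fun_subst (fun e => e 1%nat = X i (scons (e 0%nat) (fun j => e (S (S j)))))
               (fun e => f (shift e))).
      * apply (sa_apply (fun v e => v = X i e) (fun e => e 1%nat)
                 (fun e => scons (e 0%nat) (fun j => e (S (S j)))) (HX i)); [poly|].
        intros [|j]; apply pf_var.
      * apply sa_fun_comp; [exact Hf | intros; apply pf_var].
    + intros e [y [Hy HAy]]. rewrite join_S in HAy.
      destruct (Hfspec e) as [Hf1 Hf2].
      { exists (y n); split; [apply Hy; lia|]. exists y; split; [|exact HAy].
        intros i Hi; apply Hy; lia. }
      destruct (Hspec _ Hf2) as [Hb HAX].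
      split.
      * intros i Hi. destruct (Nat.eqb_spec i n) as [->|Hin]; [exact Hf1|].
        apply (Hb i); lia.
      * rewrite join_S, Nat.eqb_refl.
        rewrite (join_agree n _ (fun i => X i (scons (f e) e))); [exact HAX|].
        intros i Hi. replace (Nat.eqb i n) with false; [reflexivity|].
        symmetry; apply Nat.eqb_neq; lia.
Qed.

(** * Finite sums *)

Lemma sumR_S n f : sumR (S n) f = sumR n f + f n.
Proof.
  unfold sumR. rewrite seq_S, map_app, fold_right_app. simpl.
  generalize (map f (seq 0 n)); intros l. induction l as [|a l IH]; simpl; [ring|].
  rewrite IH; ring.
Qed.

Lemma sumR_le n f g : (forall i, (i < n)%nat -> f i <= g i) -> sumR n f <= sumR n g.
Proof.
  induction n as [|n IH]; intros H; [apply Rle_refl|].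
  rewrite !sumR_S. apply Rplus_le_compat; [|apply H; lia].
  apply IH; intros i Hi; apply H; lia.
Qed.

Lemma sumR_ext n f g : (forall i, (i < n)%nat -> f i = g i) -> sumR n f = sumR n g.
Proof. intros H; apply Rle_antisym; apply sumR_le; intros i Hi; rewrite H by exact Hi; lra. Qed.

Lemma sumR_const n c : sumR n (fun _ => c) = INR n * c.
Proof.
  induction n as [|n IH]; [unfold sumR; simpl; ring|].
  rewrite sumR_S, IH, S_INR; ring.
Qed.

Lemma sumR_add n f g : sumR n (fun i => f i + g i) = sumR n f + sumR n g.
Proof.
  induction n as [|n IH]; [unfold sumR; simpl; ring|].
  rewrite !sumR_S, IH; ring.
Qed.

Lemma sumR_scal n c f : sumR n (fun i => c * f i) = c * sumR n f.
Proof.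
  induction n as [|n IH]; [unfold sumR; simpl; ring|].
  rewrite !sumR_S, IH; ring.
Qed.

Lemma sumR_swap n m f :
  sumR n (fun i => sumR m (fun k => f i k)) = sumR m (fun k => sumR n (fun i => f i k)).
Proof.
  induction n as [|n IH].
  - unfold sumR at 1; simpl. rewrite <- (Rmult_0_r (INR m)), <- sumR_const.
    now apply sumR_ext.
  - rewrite sumR_S, IH, <- sumR_add. apply sumR_ext; intros k _. now rewrite sumR_S.
Qed.

Lemma sumR_telescope n u : sumR n (fun k => u (S k) - u k) = u n - u 0%nat.
Proof.
  induction n as [|n IH]; [unfold sumR; simpl; ring|].
  rewrite sumR_S, IH; ring.
Qed.

Lemma sumR_nonneg n f : (forall i, (i < n)%nat -> 0 <= f i) -> 0 <= sumR n f.
Proof.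
  intros H. replace 0 with (sumR n (fun _ => 0)) by (rewrite sumR_const; ring).
  now apply sumR_le.
Qed.

Lemma sumR_term_le n f i :
  (forall i, (i < n)%nat -> 0 <= f i) -> (i < n)%nat -> f i <= sumR n f.
Proof.
  induction n as [|n IH]; intros H Hi; [lia|].
  rewrite sumR_S. destruct (Nat.eq_dec i n) as [->|Hin].
  - assert (0 <= sumR n f) by (apply sumR_nonneg; intros; apply H; lia). lra.
  - assert (f i <= sumR n f) by (apply IH; [intros; apply H; lia | lia]).
    specialize (H n ltac:(lia)). lra.
Qed.

Lemma sumR_pigeonhole n f c :
  (0 < n)%nat -> sumR n f <= INR n * c -> exists k, (k < n)%nat /\ f k <= c.
Proof.
  induction n as [|n IH]; intros Hn H; [lia|].
  destruct (Rle_dec (f n) c) as [Hc|Hc]; [exists n; split; [lia | exact Hc]|].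
  rewrite sumR_S, S_INR in H.
  destruct n as [|n]; [unfold sumR in H; simpl in H; lra|].
  destruct IH as [k [Hk Hf]]; [lia | lra | exists k; split; [lia | exact Hf]].
Qed.

(** * Semialgebraic functions of one variable near 0 *)

Lemma sa_fun_lt f g : sa_fun f -> sa_fun g -> semialg (fun e => f e < g e).
Proof.
  intros Hf Hg.
  apply (sa_fun_subst (fun e => e 0%nat < g (shift e)) f); [|exact Hf].
  apply (sa_fun_subst (fun e => e 1%nat < e 0%nat) (fun e => g (shift e))).
  - apply sa_lt; poly.
  - apply sa_fun_comp; [exact Hg | intros; apply pf_var].
Qed.

Lemma sa_fun_add f g : sa_fun f -> sa_fun g -> sa_fun (fun e => f e + g e).
Proof.
  intros Hf Hg.
  apply (sa_fun_subst (fun e => e 1%nat = e 0%nat + g (fun i => e (S (S i))))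
           (fun e => f (shift e))).
  - apply (sa_fun_subst (fun e => e 2%nat = e 1%nat + e 0%nat)
             (fun e => g (fun i => e (S (S i))))).
    + apply sa_eq; poly.
    + apply sa_fun_comp; [exact Hg | intros; apply pf_var].
  - apply sa_fun_comp; [exact Hf | intros; apply pf_var].
Qed.

Lemma sa_fun_poly F : polyfun F -> sa_fun F.
Proof.
  intros HF. apply sa_eq; [poly|]. apply (pf_subst F shift HF). intros; apply pf_var.
Qed.

Definition sa_fun1 (x : R -> R) : Prop := sa_fun (fun e => x (e 0%nat)).

Lemma sa_fun1_comp x F : sa_fun1 x -> polyfun F -> sa_fun (fun e => x (F e)).
Proof. intros Hx HF. now apply (sa_fun_comp (fun e => x (e 0%nat)) (fun e _ => F e)). Qed.

(** The relation [x t < x (t + h)] holds or fails on a whole cusp. This compares points at distance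
    [h < t ^ N] only, so no continuity or global monotonicity is involved. *)
Lemma sa_fun1_monotone x : sa_fun1 x -> exists sg, Rabs sg = 1 /\
  exists (N : nat) d, 0 < d < 1 /\
    forall t h, in_cusp N d t h -> 0 <= sg * (x (t + h) - x t).
Proof.
  intros Hx.
  destruct (semialg_cusp (fun e => x (e 0%nat) < x (e 0%nat + e 1%nat)))
    as [N [d [Hd [H|H]]]].
  - apply sa_fun_lt; apply sa_fun1_comp; try exact Hx; poly.
  - exists 1; split; [apply Rabs_R1|]. exists N, d; split; [exact Hd|].
    intros t h Hth; specialize (H t h Hth); simpl in H; lra.
  - exists (-1); split; [rewrite Rabs_left; lra|]. exists N, d; split; [exact Hd|].
    intros t h Hth; specialize (H t h Hth); simpl in H; lra.
Qed.

Lemma doubling_growth_unbounded x s tau : 0 < s -> 0 < tau ->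
  (forall t, 0 < t < tau -> -1 <= x t <= 1) ->
  ~ (forall t, 0 < t < tau -> x t + s <= x (2 * t)).
Proof.
  intros Hs Ht Hb H.
  assert (Hk : forall k, exists t, 0 < t < tau /\ x t + INR k * s <= 1).
  { induction k as [|k [t [Htk IH]]].
    - exists (tau / 2); split; [lra|]. simpl. specialize (Hb (tau / 2) ltac:(lra)). lra.
    - exists (t / 2); split; [lra|]. rewrite S_INR.
      specialize (H (t / 2) ltac:(lra)). replace (2 * (t / 2)) with t in H by field. lra. }
  destruct (INR_archimed s 2 Hs) as [k Hk2]. destruct (Hk k) as [t [Htk Hx]].
  specialize (Hb t Htk). lra.
Qed.

(* Otherwise some jump size [s] is exceeded for all small [t], with constant sign by
   [semialg_germ], and summing the jumps along [t / 2^k] contradicts boundedness. *)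
Lemma sa_fun1_small_doubling x d0 : sa_fun1 x -> 0 < d0 ->
  (forall t, 0 < t < d0 -> -1 <= x t <= 1) ->
  exists (N : nat) d, 0 < d < 1 /\
    forall s t, in_cusp N d s t -> Rabs (x (2 * t) - x t) < s.
Proof.
  intros Hx Hd0 Hb.
  assert (Hx2 : sa_fun (fun e => x (2 * e 0%nat))) by (apply sa_fun1_comp; [exact Hx | poly]).
  assert (Hx2' : sa_fun (fun e => x (2 * e 1%nat))) by (apply sa_fun1_comp; [exact Hx | poly]).
  assert (Hx1' : sa_fun (fun e => x (e 1%nat))) by (apply sa_fun1_comp; [exact Hx | poly]).
  assert (Hs : sa_fun (fun e => e 0%nat)) by (apply sa_fun_poly; poly).
  destruct (semialg_cusp (fun e => x (2 * e 1%nat) < x (e 1%nat) + e 0%nat /\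
                                   x (e 1%nat) < x (2 * e 1%nat) + e 0%nat))
    as [N [d [Hd [H|H]]]].
  - apply sa_and; apply sa_fun_lt; try assumption; now apply sa_fun_add.
  - exists N, d; split; [exact Hd|]. intros s t Hst; specialize (H s t Hst); simpl in H.
    apply Rabs_def1; lra.
  - exfalso.
    destruct (semialg_germ (fun e => x (e 0%nat) < x (2 * e 0%nat))) as [d' [Hd' Hsign]].
    { now apply sa_fun_lt. }
    assert (Hs0 : 0 < (d / 2) ^ N) by (apply pow_lt; lra).
    (* The jump size is fixed at [d / 2]; for [t] below [(d / 2) ^ N] the pair [(d / 2, t)] lies in
       the cusp. *)
    set (tau := Rmin (Rmin d' d0) ((d / 2) ^ N)).
    assert (Htau : 0 < tau) by (unfold tau; repeat apply Rmin_glb_lt; lra).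
    assert (Hle : tau <= d' /\ tau <= d0 /\ tau <= (d / 2) ^ N).
    { unfold tau. pose proof (Rmin_l (Rmin d' d0) ((d / 2) ^ N)).
      pose proof (Rmin_r (Rmin d' d0) ((d / 2) ^ N)).
      pose proof (Rmin_l d' d0). pose proof (Rmin_r d' d0). lra. }
    assert (Hjump : forall t, 0 < t < tau ->
              x t + d / 2 <= x (2 * t) \/ x (2 * t) + d / 2 <= x t).
    { intros t Ht. assert (Hin : in_cusp N d (d / 2) t) by (split; lra).
      specialize (H _ _ Hin); simpl in H.
      destruct (Rle_lt_dec (x t + d / 2) (x (2 * t))); [now left|].
      destruct (Rle_lt_dec (x (2 * t) + d / 2) (x t)); [now right|].
      exfalso; apply H; split; lra. }
    destruct Hsign as [Hup|Hdown]; simpl in *.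
    + apply (doubling_growth_unbounded x (d / 2) tau); try lra.
      * intros t Ht; apply Hb; lra.
      * intros t Ht; specialize (Hup t ltac:(lra)). destruct (Hjump t Ht); lra.
    + apply (doubling_growth_unbounded (fun t => - x t) (d / 2) tau); try lra.
      * intros t Ht; specialize (Hb t ltac:(lra)); lra.
      * intros t Ht; specialize (Hdown t ltac:(lra)). destruct (Hjump t Ht); lra.
Qed.

(** Raising the exponent and narrowing the width only shrink a cusp, so finitely many can be merged,
    together with prescribed bounds [N0] and [d0]. *)
Lemma uniform_cusp n (P : nat -> R -> R -> Prop) N0 d0 : 0 < d0 < 1 ->
  (forall i, (i < n)%nat -> exists (N : nat) d, 0 < d < 1 /\
     forall s t, in_cusp N d s t -> P i s t) ->
  exists (N : nat) d, (N0 <= N)%nat /\ 0 < d <= d0 /\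
    forall i, (i < n)%nat -> forall s t, in_cusp N d s t -> P i s t.
Proof.
  intros Hd0; induction n as [|n IH]; intros H.
  - exists N0, d0; split; [lia|]; split; [lra|]. intros; lia.
  - destruct IH as [N [d [HN [Hd HP]]]]; [intros; apply H; lia|].
    destruct (H n ltac:(lia)) as [N' [d' [Hd' HP']]].
    assert (Hm : 0 < Rmin d d') by (apply Rmin_glb_lt; lra).
    pose proof (Rmin_l d d'); pose proof (Rmin_r d d').
    exists (Nat.max N N'), (Rmin d d'); split; [lia|]; split; [lra|].
    intros i Hi s t Hst. destruct (Nat.eq_dec i n) as [->|Hin].
    + apply HP'. apply (in_cusp_shrink N' (Nat.max N N') d' (Rmin d d')); try lra; [lia|exact Hst].
    + apply HP; [lia|].
      apply (in_cusp_shrink N (Nat.max N N') d (Rmin d d')); try lra; [lia|exact Hst].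
Qed.

(** * Arcs along which the gradient is small *)

(** The square keeps the gradient norm polynomial. Distances are measured in the l1 norm instead,
    because the length of an arc then splits into one telescoping sum per coordinate. *)
Definition gradsq (n : nat) (D : nat -> env -> R) (x : env) : R :=
  sumR n (fun i => D i x ^ 2).

Definition dist1 (n : nat) (x y : env) : R := sumR n (fun i => Rabs (y i - x i)).

Definition first_order (n : nat) (F : env -> R) (D : nat -> env -> R) (C : R) : Prop :=
  forall x y, box n x -> box n y ->
    F y - F x <= sumR n (fun i => D i x * (y i - x i)) + C * dist1 n x y ^ 2.

Lemma gradsq_nonneg n D x : 0 <= gradsq n D x.
Proof. apply sumR_nonneg; intros i _; apply pow2_ge_0. Qed.

Lemma dist1_nonneg n x y : 0 <= dist1 n x y.
Proof. apply sumR_nonneg; intros i _; apply Rabs_pos. Qed.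

Lemma gradsq_dist1 n D x y :
  sumR n (fun i => D i x * (y i - x i)) <= sqrt (gradsq n D x) * dist1 n x y.
Proof.
  unfold dist1. rewrite <- sumR_scal. apply sumR_le; intros i Hi.
  assert (HD : Rabs (D i x) <= sqrt (gradsq n D x)).
  { rewrite <- sqrt_Rsqr_abs. apply sqrt_le_1_alt. rewrite Rsqr_pow2.
    apply (sumR_term_le n (fun i => D i x ^ 2)); [intros; apply pow2_ge_0 | exact Hi]. }
  apply Rle_trans with (Rabs (D i x) * Rabs (y i - x i)).
  - rewrite <- Rabs_mult. apply Rle_abs.
  - apply Rmult_le_compat_r; [apply Rabs_pos | exact HD].
Qed.

(** Cancelling [t ^ q] leaves [t <= 2 ^ (2q + 1) * L ^ (q + 1)]. It combines [t / 2 <= g * L] with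
    the flatness bound on [g ^ (q + 1)]. *)
Lemma pow_le_reg_scale t L q :
  0 < t -> 0 <= L -> (t / 2) ^ S q <= (2 * t) ^ q * L ^ S q -> t <= (4 * L) ^ S q.
Proof.
  intros Ht HL H.
  assert (Hq : 0 < t ^ q) by now apply pow_lt.
  assert (H2 : 0 < 2 ^ q) by (apply pow_lt; lra).
  assert (H4 : 4 ^ q = 2 ^ q * 2 ^ q) by (rewrite <- Rpow_mult_distr; f_equal; lra).
  unfold Rdiv in H. rewrite Rpow_mult_distr, pow_inv, Rpow_mult_distr in H.
  rewrite Rpow_mult_distr. simpl in *. rewrite H4.
  set (l := L * L ^ q) in *.
  assert (Hl : 0 <= l) by (unfold l; apply Rmult_le_pos; [|apply pow_le]; exact HL).
  apply (Rmult_le_compat_r (2 * 2 ^ q)) in H; [|lra].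
  rewrite Rmult_assoc, Rinv_l, Rmult_1_r in H by lra.
  apply Rmult_le_reg_l with (t ^ q); [exact Hq|].
  assert (0 <= t ^ q * (2 ^ q * 2 ^ q) * l)
    by (apply Rmult_le_pos; [|exact Hl]; apply Rlt_le, Rmult_lt_0_compat; nra).
  nra.
Qed.

(* On [[t, 2t]] with [t = s^N / 2] the arc has length at most [n s], while [F]
   grows by [t]; hence the gradient cannot stay below [t ^ (1 - 1/(2N))].  Cutting the
   arc into equal time steps, the second-order error of its shortest step is negligible. *)
Lemma no_flat_arc n F D C (X : R -> env) N0 d0 :
  0 < d0 < 1 -> first_order n F D C ->
  (forall i, sa_fun1 (fun t => X t i)) ->
  (forall t, 0 < t < d0 -> box n (X t) /\ F (X t) = t) ->
  exists N, (N0 <= N)%nat /\ (1 <= N)%nat /\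
    ~ exists del, 0 < del /\
        forall t, 0 < t < del -> gradsq n D (X t) ^ N < t ^ (2 * N - 1).
Proof.
  intros Hd0 Htaylor HX HXF.
  set (sgP := fun i sg => Rabs sg = 1 /\ exists (N : nat) d, 0 < d < 1 /\
    forall t h, in_cusp N d t h -> 0 <= sg * (X (t + h) i - X t i)).
  set (sg := fun i => epsilon (inhabits 0) (sgP i)).
  assert (Hsg : forall i, sgP i (sg i)).
  { intros i. apply epsilon_spec. apply (sa_fun1_monotone _ (HX i)). }
  destruct (uniform_cusp n (fun i t h => 0 <= sg i * (X (t + h) i - X t i))
              (Nat.max 1 N0) d0 Hd0) as [N1 [d1 [HN1 [Hd1 Hmono1]]]].
  { intros i _. apply (Hsg i). }
  destruct (uniform_cusp n (fun i s t => Rabs (X (2 * t) i - X t i) < s) N1 d1 ltac:(lra))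
    as [N [d [HN [Hd Hjump]]]].
  { intros i Hi. apply (sa_fun1_small_doubling (fun t => X t i) d0 (HX i)); [lra|].
    intros t Ht. now apply (HXF t Ht). }
  assert (Hmono : forall i, (i < n)%nat -> forall t h, in_cusp N d t h ->
            0 <= sg i * (X (t + h) i - X t i)).
  { intros i Hi t h Hth. apply Hmono1; [exact Hi|].
    apply (in_cusp_shrink N1 N d1 d); try lra; [lia | exact Hth]. }
  clear Hmono1. exists N; split; [lia|]; split; [lia|]. intros [del [Hdel Hflat]].
  set (n' := INR n + 1).
  assert (Hn' : 1 <= n') by (unfold n'; pose proof (pos_INR n); lra).
  (* Chosen so that [s <= b] gives [(4 n s)^2 <= s / 8], the final contradiction; [n'] avoids a
     division by 0. *)
  set (b := / (128 * (n' * n'))).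
  assert (Hb : 0 < b) by (apply Rinv_0_lt_compat; nra).
  assert (Hbn : b * (128 * (n' * n')) = 1) by (apply Rinv_l; nra).
  set (s := Rmin (Rmin (d / 2) (del / 2)) b).
  assert (Hs0 : 0 < s) by (unfold s; repeat apply Rmin_glb_lt; lra).
  assert (Hsle : s <= d / 2 /\ s <= del / 2 /\ s <= b).
  { unfold s. pose proof (Rmin_l (Rmin (d / 2) (del / 2)) b).
    pose proof (Rmin_r (Rmin (d / 2) (del / 2)) b).
    pose proof (Rmin_l (d / 2) (del / 2)). pose proof (Rmin_r (d / 2) (del / 2)). lra. }
  clearbody s.
  set (t := s ^ N / 2).
  assert (HsN : 0 < s ^ N) by now apply pow_lt.
  assert (HsN1 : s ^ N <= s).
  { rewrite <- (pow_1 s) at 2. apply pow_antitone; [lra | lia]. }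
  assert (Ht : 0 < t) by (unfold t; lra).
  assert (Ht2 : 2 * t = s ^ N) by (unfold t; field).
  set (L := INR n * s).
  assert (HL : 0 <= L) by (apply Rmult_le_pos; [apply pos_INR | lra]).
  assert (HtN : 0 < t ^ N) by now apply pow_lt.
  (* [M1] makes the time step [h = t / M] smaller than [t ^ N], hence admissible for monotonicity at
     every point of [[t, 2t]]; [M2] makes [M] times the second-order error of the shortest step at
     most [t / 2]. *)
  destruct (INR_archimed (t ^ N) t HtN) as [M1 HM1].
  destruct (INR_archimed t (2 * (Rabs C * L ^ 2)) Ht) as [M2 HM2].
  set (M := (M1 + M2 + 1)%nat).
  assert (HMR : INR M = INR M1 + INR M2 + 1) by (unfold M; rewrite !plus_INR; simpl; ring).
  pose proof (pos_INR M1); pose proof (pos_INR M2).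
  assert (HM0 : 0 < INR M) by lra.
  assert (HMa : t < INR M * t ^ N) by nra.
  assert (HMb : 2 * (Rabs C * L ^ 2) < INR M * t) by nra.
  set (h := t / INR M).
  assert (Hh : 0 < h) by (apply Rdiv_lt_0_compat; lra).
  assert (HhM : INR M * h = t) by (unfold h; field; lra).
  assert (HhN : h < t ^ N) by (apply Rmult_lt_reg_l with (INR M); lra).
  set (tk := fun k => t + INR k * h).
  assert (Htk : forall k, (k <= M)%nat -> t <= tk k <= 2 * t).
  { intros k Hk. apply le_INR in Hk. pose proof (pos_INR k). unfold tk. nra. }
  assert (HtkS : forall k, tk (S k) = tk k + h) by (intros k; unfold tk; rewrite S_INR; ring).
  (* After exchanging the sums, all increments of coordinate [i] have the sign [sg i], so their
     absolute values telescope to the jump from [t] to [2t], which is less than [s]. *)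
  assert (Hlength : sumR M (fun k => dist1 n (X (tk k)) (X (tk (S k)))) <= L).
  { unfold dist1. rewrite <- sumR_swap. unfold L. rewrite <- sumR_const.
    apply sumR_le; intros i Hi.
    rewrite (sumR_ext M _ (fun k => sg i * X (tk (S k)) i - sg i * X (tk k) i)).
    - rewrite (sumR_telescope M (fun k => sg i * X (tk k) i)), <- Rmult_minus_distr_l.
      replace (tk M) with (2 * t) by (unfold tk; lra).
      replace (tk 0%nat) with t by (unfold tk; simpl; ring).
      apply Rle_trans with (1 := Rle_abs _).
      rewrite Rabs_mult. destruct (Hsg i) as [-> _]. rewrite Rmult_1_l.
      apply Rlt_le, (Hjump i Hi). split; lra.
    - intros k Hk. rewrite <- Rmult_minus_distr_l.
      assert (Htk' := Htk k ltac:(lia)).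
      assert (Hpos : 0 <= sg i * (X (tk (S k)) i - X (tk k) i)).
      { rewrite HtkS. apply (Hmono i Hi). split; [lra|]. split; [exact Hh|].
        apply Rlt_le_trans with (1 := HhN). apply pow_incr; lra. }
      rewrite <- (Rabs_right (sg i * _)) by lra.
      rewrite Rabs_mult. destruct (Hsg i) as [-> _]. ring. }
  destruct (sumR_pigeonhole M (fun k => dist1 n (X (tk k)) (X (tk (S k)))) (L / INR M))
    as [k [Hk Hshort]].
  { unfold M; lia. }
  { replace (INR M * (L / INR M)) with L by (field; lra). exact Hlength. }
  cbv beta in Hshort.
  set (a := dist1 n (X (tk k)) (X (tk (S k)))) in *.
  assert (Ha : 0 <= a) by apply dist1_nonneg.
  assert (HaM : INR M * a <= L).
  { replace L with (INR M * (L / INR M)) by (field; lra).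
    apply Rmult_le_compat_l; lra. }
  assert (Htk1 := Htk k ltac:(lia)). assert (Htk2 := Htk (S k) ltac:(lia)).
  destruct (HXF (tk k) ltac:(lra)) as [Hbox1 HF1].
  destruct (HXF (tk (S k)) ltac:(lra)) as [Hbox2 HF2].
  pose proof (Htaylor _ _ Hbox1 Hbox2) as Hstep. fold a in Hstep.
  pose proof (gradsq_dist1 n D (X (tk k)) (X (tk (S k)))) as Hlin. fold a in Hlin.
  set (g := sqrt (gradsq n D (X (tk k)))) in *.
  assert (Hg : 0 <= g) by apply sqrt_pos.
  (* Along this step [F] grows by [h]. Multiplying the first-order estimate by [M], with
     [M * a <= L], gives [t <= g * L] up to an error of at most [t / 2]. *)
  assert (Hhalf : t / 2 <= g * L).
  { assert (Hh1 : h <= g * a + Rabs C * a ^ 2).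
    { pose proof (Rle_abs C). pose proof (pow2_ge_0 a).
      assert (C * a ^ 2 <= Rabs C * a ^ 2) by now apply Rmult_le_compat_r.
      pose proof (HtkS k). rewrite HF1, HF2 in Hstep. lra. }
    assert (Hh2 : INR M * h <= g * (INR M * a) + Rabs C * (INR M * a) * a).
    { replace (g * (INR M * a) + Rabs C * (INR M * a) * a)
        with (INR M * (g * a + Rabs C * a ^ 2)) by ring.
      apply Rmult_le_compat_l; lra. }
    assert (Hg1 : g * (INR M * a) <= g * L) by now apply Rmult_le_compat_l.
    pose proof (Rabs_pos C) as HC.
    assert (Hc1 : INR M * (Rabs C * (INR M * a) * a) <= Rabs C * L ^ 2).
    { replace (INR M * (Rabs C * (INR M * a) * a)) with (Rabs C * (INR M * a) ^ 2) by ring.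
      apply Rmult_le_compat_l; [exact HC|]. apply pow_incr; split; [|exact HaM].
      apply Rmult_le_pos; lra. }
    assert (Rabs C * (INR M * a) * a <= t / 2); [|lra].
    apply Rmult_le_reg_l with (INR M); lra. }
  assert (Hgpow : g ^ (2 * N) <= (2 * t) ^ (2 * N - 1)).
  { rewrite pow_mult. unfold g. rewrite pow2_sqrt by apply gradsq_nonneg.
    apply Rle_trans with (tk k ^ (2 * N - 1)).
    - apply Rlt_le, Hflat. lra.
    - apply pow_incr. lra. }
  assert (Hmain : t <= (4 * L) ^ (2 * N)).
  { replace (2 * N)%nat with (S (2 * N - 1)) by lia. apply pow_le_reg_scale; try assumption.
    replace (S (2 * N - 1)) with (2 * N)%nat by lia.
    apply Rle_trans with ((g * L) ^ (2 * N)); [apply pow_incr; lra|].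
    rewrite Rpow_mult_distr. apply Rmult_le_compat_r; [now apply pow_le | exact Hgpow]. }
  assert (Hn : INR n <= n') by (unfold n'; lra).
  (* Then [t <= (4 L)^(2N) <= (s / 8)^N <= s^N / 8], against [t = s^N / 2]. *)
  assert (HLs : (4 * L) ^ 2 <= s * (1 / 8)).
  { assert (HL1 : L <= n' * s) by (apply Rmult_le_compat_r; lra).
    assert (HL2 : L ^ 2 <= (n' * s) ^ 2) by (apply pow_incr; lra).
    assert (Hsb : s * (128 * (n' * n')) <= 1) by (rewrite <- Hbn; apply Rmult_le_compat_r; nra).
    apply (Rmult_le_compat_l s) in Hsb; [|lra]. nra. }
  rewrite pow_mult in Hmain.
  assert (Hfin : ((4 * L) ^ 2) ^ N <= (s * (1 / 8)) ^ N).
  { apply pow_incr. split; [apply pow2_ge_0 | exact HLs]. }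
  rewrite (Rpow_mult_distr s) in Hfin.
  assert (H8 : (1 / 8) ^ N <= 1 / 8).
  { rewrite <- (pow_1 (1 / 8)) at 2. apply pow_antitone; [lra | lia]. }
  assert (s ^ N * (1 / 8) ^ N <= s ^ N * (1 / 8)) by (apply Rmult_le_compat_l; lra).
  unfold t in Hmain. lra.
Qed.

(** * The gradient inequality on a bounded semialgebraic set *)

Lemma pf_gradsq n D : (forall i, polyfun (D i)) -> polyfun (gradsq n D).
Proof.
  intros HD; induction n as [|n IH].
  - exact (pf_const 0).
  - replace (gradsq (S n) D) with (fun x => gradsq n D x + D n x ^ 2).
    + apply pf_add; [exact IH | now apply pf_pow].
    + apply functional_extensionality; intros x. unfold gradsq; now rewrite sumR_S.
Qed.

(** Environments are infinite, points have [n] coordinates. [T] is [R] for functions and [Prop] for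
    sets. *)
Definition depends_on (n : nat) {T} (F : env -> T) : Prop :=
  forall x y, (forall i, (i < n)%nat -> x i = y i) -> F x = F y.

Lemma depends_on_join n {T} (F : env -> T) y e : depends_on n F -> F (join n y e) = F y.
Proof. intros H; apply H; intros i Hi. now apply join_lt. Qed.

Lemma join_n n y e : join n y e n = e 0%nat.
Proof. pose proof (join_ge n y e 0) as H. now rewrite Nat.add_0_r in H. Qed.

(** If the inequality failed along the arc for all small levels, the arc would be flat, which is
    impossible; being semialgebraic, the failure then occurs at no small level. As the arc almost
    minimizes the gradient on its level set, the inequality passes to every point, at the price of
    the factor 4. *)
Lemma lojasiewicz_semialg n F D C (K : env -> Prop) N0 :
  polyfun F -> (forall i, polyfun (D i)) -> semialg K ->
  depends_on n F -> depends_on n (gradsq n D) -> depends_on n K ->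
  first_order n F D C ->
  (forall x, K x -> box n x) ->
  (exists c, 0 < c /\ forall x, K x -> 0 < F x -> c * F x ^ 2 <= gradsq n D x) ->
  exists N del, (N0 <= N)%nat /\ (1 <= N)%nat /\ 0 < del /\
    forall x, K x -> 0 < F x < del -> F x ^ (2 * N - 1) <= (4 * gradsq n D x) ^ N.
Proof.
  intros HF HD HK dF dG dK Htaylor Hbox [c [Hc Hpos]].
  assert (HG := pf_gradsq n D HD). set (G := gradsq n D) in *.
  destruct (semialg_germ (fun e => exists y, K (join n y e) /\ F (join n y e) = join n y e n))
    as [d [Hd [Hne|Hempty]]].
  { apply (sa_ex_vec n (fun e => K e /\ F e = e n)).
    apply sa_and; [exact HK | apply sa_eq; [exact HF | poly]]. }
  (* No small positive level is attained, so the claim is void below [d]. *)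
  2:{ exists (Nat.max 1 N0), d; split; [lia|]; split; [lia|]; split; [lra|].
      intros x Hx HFx. exfalso. apply (Hempty (F x) HFx). exists x.
      rewrite join_n, !depends_on_join by assumption. now split. }
  set (S := fun e => K e /\ F e = e n /\
    forall z, K (join n z e) /\ F (join n z e) = e n -> G e <= 4 * G (join n z e)).
  assert (HS : semialg S).
  { apply sa_and; [exact HK|]. apply sa_and; [apply sa_eq; [exact HF | poly]|].
    (* Three blocks of variables: the competitor [z] at indices below [n], the candidate at [n] to
       [2n - 1], the level at [2n]. *)
    apply (sa_ext (fun e => forall z, (fun e' => K e' /\ F e' = e' (n + n)%nat ->
             G (fun i => e' (n + i)%nat) <= 4 * G e') (join n z e))).
    - intros e. split; intros H z; specialize (H z); cbv beta in *; rewrite join_ge in *;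
        replace (fun i => join n z e (n + i)%nat) with e in *; try exact H;
        apply functional_extensionality; intros i; symmetry; apply join_ge.
    - apply (sa_all_vec n (fun e' => K e' /\ F e' = e' (n + n)%nat ->
             G (fun i => e' (n + i)%nat) <= 4 * G e')).
      apply sa_imp.
      + apply sa_and; [exact HK | apply sa_eq; [exact HF | poly]].
      + apply sa_le.
        * apply (pf_subst G (fun e' i => e' (n + i)%nat) HG). intros; apply pf_var.
        * apply pf_mul; [apply pf_const | exact HG]. }
  destruct (sa_choice_vec n S HS) as [X [HX HXS]].
  set (x := fun t i => X i (scons t env0)).
  assert (Hx : forall t, 0 < t < d -> K (x t) /\ F (x t) = t /\
            forall z, K z -> F z = t -> G (x t) <= 4 * G z).
  { intros t Ht. destruct (HXS (scons t env0)) as [_ [H1 [H2 H3]]].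
    - destruct (Hne t Ht) as [y [Hy HFy]].
      rewrite join_n, !depends_on_join in * by assumption. simpl in HFy.
      destruct (inf_exists (fun v => exists z, K z /\ F z = t /\ v = G z) (c * t ^ 2))
        as [a [Ha1 Ha2]].
      { now exists (G y), y. }
      { intros v [z [Hz [<- ->]]]. apply Hpos; [exact Hz | lra]. }
      (* Positivity of the infimum [a] gives [a < 4 * a], hence a point of the level set with
         [G z < 4 * a]. *)
      assert (Ha : 0 < a).
      { apply Rlt_le_trans with (c * t ^ 2).
        - apply Rmult_lt_0_compat; [exact Hc | apply pow_lt; lra].
        - apply Ha2. intros v [z [Hz [<- ->]]]. apply Hpos; [exact Hz | lra]. }
      assert (Hz : exists z, K z /\ F z = t /\ G z < 4 * a).
      { apply NNPP; intros Hn. assert (4 * a <= a); [|lra].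
        apply Ha2. intros v [z [Hz [HFz ->]]]. apply Rnot_lt_le; intros Hlt.
        apply Hn. now exists z. }
      destruct Hz as [z [Hz [HFz HGz]]]. exists z; split; [now apply Hbox|].
      unfold S. rewrite join_n, !depends_on_join by assumption.
      split; [exact Hz|]; split; [exact HFz|].
      intros w. rewrite !depends_on_join by assumption. intros [Hw HFw].
      assert (a <= G w) by (apply Ha1; now exists w). lra.
    - rewrite join_n, !depends_on_join in * by assumption.
      split; [exact H1|]; split; [exact H2|].
      intros z Hz HFz. specialize (H3 z). rewrite !depends_on_join in H3 by assumption.
      apply H3. now split. }
  destruct (no_flat_arc n F D C x N0 d) as [N [HN0 [HN1 Hnot]]]; try assumption.
  { intros i. apply (sa_fun_comp (X i) (fun e => scons (e 0%nat) env0) (HX i)).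
    intros [|j]; [apply pf_var | apply (pf_const 0)]. }
  { intros t Ht. destruct (Hx t Ht) as [H1 [H2 _]]. split; [now apply Hbox | exact H2]. }
  destruct (semialg_germ (fun e => G (join n (fun i => X i e) e) ^ N <
              join n (fun i => X i e) e n ^ (2 * N - 1))) as [d' [Hd' [H|H]]].
  - apply (sa_fun_subst_vec n (fun e => G e ^ N < e n ^ (2 * N - 1)) X); [|exact HX].
    apply sa_lt; apply pf_pow; [exact HG | poly].
  - exfalso; apply Hnot. exists d'; split; [lra|]. intros t Ht. specialize (H t Ht).
    now rewrite join_n, depends_on_join in H by assumption.
  - exists N, (Rmin d d').
    assert (0 < Rmin d d') by (apply Rmin_glb_lt; lra).
    pose proof (Rmin_l d d'); pose proof (Rmin_r d d').
    split; [exact HN0|]; split; [exact HN1|]; split; [assumption|].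
    intros y Hy HFy. specialize (H (F y) ltac:(lra)).
    rewrite join_n, depends_on_join in H by assumption. simpl in H.
    apply Rnot_lt_le in H. apply Rle_trans with (1 := H).
    apply pow_incr. split; [apply gradsq_nonneg|].
    apply (Hx (F y)); [lra | exact Hy | reflexivity].
Qed.

(** * Taylor estimates for polynomials *)

Definition bounded_by (n : nat) (B : R) (x : env) : Prop :=
  forall i, (i < n)%nat -> Rabs (x i) <= B.

(** The bounds on values and on increments carry the induction through products, whose remainder
    contains both. Partial derivatives are built along with the polynomial and identified with
    [is_gradient] only afterwards. *)
Definition taylor (n : nat) (F : env -> R) (D : nat -> env -> R) : Prop :=
  forall B, exists C, forall x y, bounded_by n B x -> bounded_by n B y ->
    Rabs (F x) <= C /\ Rabs (F y - F x) <= C * dist1 n x y /\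
    Rabs (F y - F x - sumR n (fun i => D i x * (y i - x i))) <= C * dist1 n x y ^ 2.

Definition smooth (n : nat) (F : env -> R) : Prop :=
  polyfun F /\ exists D, (forall i, polyfun (D i)) /\
    (forall i, depends_on n (D i)) /\ taylor n F D.

Lemma sumR_delta n j f :
  (j < n)%nat -> sumR n (fun i => (if Nat.eqb i j then 1 else 0) * f i) = f j.
Proof.
  induction n as [|n IH]; intros Hj; [lia|].
  rewrite sumR_S. destruct (Nat.eqb_spec n j) as [->|Hnj].
  - rewrite (sumR_ext j _ (fun _ => 0)).
    + rewrite sumR_const; ring.
    + intros i Hi. destruct (Nat.eqb_spec i j); [lia | ring].
  - rewrite IH by lia. ring.
Qed.

(** Points with equal first [n] coordinates are at distance 0, where the Lipschitz estimate forces
    equality. *)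
Lemma taylor_depends n F D : taylor n F D -> depends_on n F.
Proof.
  intros HF x y Hxy.
  set (B := sumR n (fun i => Rabs (x i))).
  assert (Hx : bounded_by n B x).
  { intros i Hi. apply (sumR_term_le n (fun i => Rabs (x i))); [|exact Hi].
    intros; apply Rabs_pos. }
  assert (Hy : bounded_by n B y) by (intros i Hi; rewrite <- Hxy by exact Hi; now apply Hx).
  destruct (HF B) as [C HC]. destruct (HC x y Hx Hy) as [_ [H _]].
  replace (dist1 n x y) with 0 in H.
  - rewrite Rmult_0_r in H. apply Rabs_le_bounds in H. lra.
  - unfold dist1. rewrite (sumR_ext n _ (fun _ => 0)); [rewrite sumR_const; ring|].
    intros i Hi. rewrite Hxy by exact Hi. rewrite Rminus_diag. apply Rabs_R0.
Qed.

Lemma smooth_const n c : smooth n (fun _ => c).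
Proof.
  split; [apply pf_const|].
  exists (fun _ _ => 0); split; [intros; apply pf_const|]; split; [intros i x y _; reflexivity|].
  intros B. exists (Rabs c). intros x y _ _.
  pose proof (dist1_nonneg n x y). pose proof (Rabs_pos c).
  rewrite (sumR_ext n _ (fun _ => 0)) by (intros; ring).
  rewrite sumR_const, Rminus_diag, Rmult_0_r, Rminus_diag, Rabs_R0.
  split; [lra|]. split; [nra|]. pose proof (pow2_ge_0 (dist1 n x y)). nra.
Qed.

Lemma smooth_var n j : (j < n)%nat -> smooth n (fun x => x j).
Proof.
  intros Hj. split; [apply pf_var|].
  exists (fun i _ => if Nat.eqb i j then 1 else 0).
  split; [intros; apply pf_const|]; split; [intros i x y _; reflexivity|].
  intros B. exists (Rmax 1 B). intros x y Hx Hy.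
  pose proof (Rmax_l 1 B). pose proof (Rmax_r 1 B).
  pose proof (dist1_nonneg n x y).
  rewrite (sumR_delta n j (fun i => y i - x i) Hj), Rminus_diag, Rabs_R0.
  assert (Hd : Rabs (y j - x j) <= dist1 n x y).
  { apply (sumR_term_le n (fun i => Rabs (y i - x i))); [intros; apply Rabs_pos | exact Hj]. }
  specialize (Hx j Hj).
  split; [lra|]. split; [nra|]. pose proof (pow2_ge_0 (dist1 n x y)). nra.
Qed.

Lemma smooth_add n F G : smooth n F -> smooth n G -> smooth n (fun x => F x + G x).
Proof.
  intros [pF [DF [HDF [dF TF]]]] [pG [DG [HDG [dG TG]]]].
  split; [now apply pf_add|].
  exists (fun i x => DF i x + DG i x); split; [intros; now apply pf_add|]; split.
  { intros i x y Hxy. now rewrite (dF i x y Hxy), (dG i x y Hxy). }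
  intros B. destruct (TF B) as [CF HF]. destruct (TG B) as [CG HG].
  exists (CF + CG). intros x y Hx Hy.
  destruct (HF x y Hx Hy) as [F1 [F2 F3]]. destruct (HG x y Hx Hy) as [G1 [G2 G3]].
  rewrite (sumR_ext n _ (fun i => DF i x * (y i - x i) + DG i x * (y i - x i)))
    by (intros; ring).
  rewrite sumR_add, !Rmult_plus_distr_r. split; [|split].
  - eapply Rle_trans; [apply Rabs_triang | lra].
  - replace (F y + G y - (F x + G x)) with ((F y - F x) + (G y - G x)) by ring.
    eapply Rle_trans; [apply Rabs_triang | lra].
  - set (lF := sumR n (fun i => DF i x * (y i - x i))) in *.
    set (lG := sumR n (fun i => DG i x * (y i - x i))) in *.
    replace (F y + G y - (F x + G x) - (lF + lG))
      with ((F y - F x - lF) + (G y - G x - lG)) by ring.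
    eapply Rle_trans; [apply Rabs_triang | lra].
Qed.

Lemma smooth_mul n F G : smooth n F -> smooth n G -> smooth n (fun x => F x * G x).
Proof.
  intros [pF [DF [HDF [dF TF]]]] [pG [DG [HDG [dG TG]]]].
  split; [now apply pf_mul|].
  exists (fun i x => F x * DG i x + G x * DF i x).
  split; [intros; apply pf_add; now apply pf_mul|]; split.
  { intros i x y Hxy.
    rewrite (dF i x y Hxy), (dG i x y Hxy).
    now rewrite (taylor_depends n F DF TF x y Hxy), (taylor_depends n G DG TG x y Hxy). }
  intros B. destruct (TF B) as [CF HF]. destruct (TG B) as [CG HG].
  (* One [CF * CG] for each part of the remainder: [F] times the remainder of [G], [G] times that of
     [F], and the product of the increments. *)
  exists (3 * (CF * CG)). intros x y Hx Hy.
  destruct (HF x y Hx Hy) as [F1 [F2 F3]]. destruct (HG x y Hx Hy) as [G1 [G2 G3]].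
  destruct (HG y x Hy Hx) as [G1' _].
  rewrite (sumR_ext n _ (fun i => F x * (DG i x * (y i - x i)) + G x * (DF i x * (y i - x i))))
    by (intros; ring).
  rewrite sumR_add, !sumR_scal.
  set (lF := sumR n (fun i => DF i x * (y i - x i))) in *.
  set (lG := sumR n (fun i => DG i x * (y i - x i))) in *.
  set (l := dist1 n x y) in *.
  assert (Hl : 0 <= l) by apply dist1_nonneg.
  pose proof (Rabs_pos (F x)) as pFx. pose proof (Rabs_pos (G x)) as pGx.
  assert (HCF : 0 <= CF) by lra. assert (HCG : 0 <= CG) by lra.
  assert (prod : forall a b A B0, Rabs a <= A -> Rabs b <= B0 -> Rabs (a * b) <= A * B0).
  { intros a b A B0 Ha Hb. rewrite Rabs_mult.
    apply Rmult_le_compat; auto using Rabs_pos. }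
  assert (HC : 0 <= CF * CG) by now apply Rmult_le_pos.
  assert (HCl : 0 <= CF * CG * l) by now apply Rmult_le_pos.
  split; [|split].
  - pose proof (prod _ _ _ _ F1 G1). lra.
  - replace (F y * G y - F x * G x) with (F x * (G y - G x) + G y * (F y - F x)) by ring.
    eapply Rle_trans; [apply Rabs_triang|].
    pose proof (prod _ _ _ _ F1 G2). pose proof (prod _ _ _ _ G1' F2). lra.
  - replace (F y * G y - F x * G x - (F x * lG + G x * lF))
      with (F x * (G y - G x - lG) + G x * (F y - F x - lF) + (F y - F x) * (G y - G x))
      by ring.
    eapply Rle_trans; [apply Rabs_triang|].
    eapply Rle_trans; [apply Rplus_le_compat_r, Rabs_triang|].
    pose proof (prod _ _ _ _ F1 G3). pose proof (prod _ _ _ _ G1 F3).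
    pose proof (prod _ _ _ _ F2 G2). lra.
Qed.

Lemma smooth_pow n F k : smooth n F -> smooth n (fun x => F x ^ k).
Proof.
  intros HF; induction k as [|k IH]; simpl; [apply smooth_const | now apply smooth_mul].
Qed.

Lemma smooth_mono n e : forall i, (i + length e <= n)%nat -> smooth n (mono_eval_aux i e).
Proof.
  induction e as [|a e IH]; intros i Hi; simpl in *.
  - apply (smooth_const n 1).
  - apply (smooth_mul n (fun x => x i ^ a)).
    + apply smooth_pow, smooth_var. lia.
    + apply IH. lia.
Qed.

Lemma smooth_poly_eval n p :
  Forall (fun t => length (snd t) = n) p -> smooth n (poly_eval p).
Proof.
  intros Hp; induction Hp as [|t p Ht Hp IH].
  - apply (smooth_const n 0).
  - apply (smooth_add n (fun x => fst t * mono_eval_aux 0 (snd t) x)); [|exact IH].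
    apply (smooth_mul n (fun _ => fst t)); [apply smooth_const|].
    apply smooth_mono. lia.
Qed.

(** Directional derivatives serve twice: a basis vector [v] gives the partial derivatives, and
    [v = x] gives Euler's identity. *)
Lemma taylor_line n F D x v : taylor n F D ->
  derivable_pt_lim (fun h => F (fun i => x i + h * v i)) 0 (sumR n (fun i => D i x * v i)).
Proof.
  intros HF eps Heps.
  set (B := sumR n (fun i => Rabs (x i) + Rabs (v i))).
  set (V := sumR n (fun i => Rabs (v i))).
  assert (HV : 0 <= V) by (apply sumR_nonneg; intros; apply Rabs_pos).
  assert (HB : forall h, Rabs h <= 1 -> bounded_by n B (fun i => x i + h * v i)).
  { intros h Hh i Hi. apply Rle_trans with (Rabs (x i) + Rabs (v i)).
    - eapply Rle_trans; [apply Rabs_triang|]. rewrite Rabs_mult.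
      pose proof (Rabs_pos (v i)). nra.
    - apply (sumR_term_le n (fun i => Rabs (x i) + Rabs (v i))); [|exact Hi].
      intros j _. pose proof (Rabs_pos (x j)). pose proof (Rabs_pos (v j)). lra. }
  destruct (HF B) as [C HC].
  set (W := Rabs C * V ^ 2).
  assert (HW : 0 <= W) by (apply Rmult_le_pos; [apply Rabs_pos | apply pow2_ge_0]).
  assert (Hdel : 0 < Rmin 1 (eps / (W + 1))).
  { apply Rmin_glb_lt; [lra | apply Rdiv_lt_0_compat; lra]. }
  exists (mkposreal _ Hdel). intros h Hh0 Hh. simpl in Hh.
  assert (Hh1 : Rabs h < 1) by (eapply Rlt_le_trans; [exact Hh | apply Rmin_l]).
  assert (Hh2 : Rabs h < eps / (W + 1)) by (eapply Rlt_le_trans; [exact Hh | apply Rmin_r]).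
  assert (Hx0 := HB 0 ltac:(rewrite Rabs_R0; lra)).
  assert (Hxh := HB h ltac:(lra)).
  replace (fun i => x i + 0 * v i) with x in *
    by (apply functional_extensionality; intros; ring).
  rewrite Rplus_0_l.
  destruct (HC _ _ Hx0 Hxh) as [_ [_ H]].
  set (y := fun i => x i + h * v i) in *.
  rewrite (sumR_ext n _ (fun i => h * (D i x * v i))) in H
    by (intros; unfold y; ring).
  rewrite sumR_scal in H. set (lin := sumR n (fun i => D i x * v i)) in *.
  assert (Hdist : dist1 n x y = Rabs h * V).
  { unfold dist1, V. rewrite <- sumR_scal. apply sumR_ext; intros i _.
    rewrite <- Rabs_mult. f_equal. unfold y; ring. }
  rewrite Hdist in H.
  replace ((F y - F x) / h - lin) with ((F y - F x - h * lin) * / h) by (field; exact Hh0).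
  rewrite Rabs_mult, Rabs_inv.
  assert (Hha : 0 < Rabs h) by now apply Rabs_pos_lt.
  apply Rmult_lt_reg_r with (Rabs h); [exact Hha|].
  rewrite Rmult_assoc, Rinv_l, Rmult_1_r by lra.
  assert (HWh : Rabs h * (W + 1) < eps).
  { apply Rmult_lt_reg_r with (/ (W + 1)); [apply Rinv_0_lt_compat; lra|].
    rewrite Rmult_assoc, Rinv_r, Rmult_1_r by lra. exact Hh2. }
  apply Rle_lt_trans with (1 := H).
  apply Rle_lt_trans with (W * (Rabs h * Rabs h)).
  - unfold W. replace (Rabs C * V ^ 2 * (Rabs h * Rabs h)) with (Rabs C * (Rabs h * V) ^ 2) by ring.
    apply Rmult_le_compat_r; [apply pow2_ge_0 | apply Rle_abs].
  - nra.
Qed.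

Lemma upd_same x j : upd x j (x j) = x.
Proof.
  apply functional_extensionality; intros i. unfold upd.
  now destruct (Nat.eqb_spec i j) as [->|].
Qed.

Lemma taylor_gradient n F D x : taylor n F D -> is_gradient n F x (fun j => D j x).
Proof.
  intros HF j Hj eps Heps.
  set (v := fun i => if Nat.eqb i j then 1 else 0).
  assert (Hline : forall h, upd x j (x j + h) = (fun i => x i + h * v i)).
  { intros h. apply functional_extensionality; intros i. unfold upd, v.
    destruct (Nat.eqb_spec i j) as [->|]; ring. }
  destruct (taylor_line n F D x v HF eps Heps) as [del Hdel].
  exists del. intros h Hh0 Hh. specialize (Hdel h Hh0 Hh). cbv beta in Hdel.
  rewrite Hline, upd_same.
  rewrite Rplus_0_l in Hdel.
  replace (fun i => x i + 0 * v i) with x in Hdel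
    by (apply functional_extensionality; intros; ring).
  rewrite (sumR_ext n _ (fun i => v i * D i x)) in Hdel by (intros; ring).
  unfold v in Hdel. rewrite (sumR_delta n j (fun i => D i x) Hj) in Hdel. exact Hdel.
Qed.

Lemma is_gradient_unique n F x g g' :
  is_gradient n F x g -> is_gradient n F x g' -> forall j, (j < n)%nat -> g j = g' j.
Proof. intros H H' j Hj. exact (uniqueness_limite _ _ _ _ (H j Hj) (H' j Hj)). Qed.

(** * Homogeneity and Euler's identity *)

Definition homogeneous_fun (m : nat) (F : env -> R) : Prop :=
  forall r x, F (fun i => r * x i) = r ^ m * F x.

Lemma mono_eval_scale r x e : forall i,
  mono_eval_aux i e (fun k => r * x k) = r ^ fold_right plus 0%nat e * mono_eval_aux i e x.
Proof.
  induction e as [|a e IH]; intros i; simpl; [ring|].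
  rewrite IH, Rpow_mult_distr, pow_add. ring.
Qed.

Lemma poly_eval_homogeneous n m p :
  homogeneous_poly n m p -> homogeneous_fun m (poly_eval p).
Proof.
  intros Hp r x; induction Hp as [|t p [_ Ht] Hp IH].
  - unfold poly_eval; simpl; ring.
  - unfold poly_eval in *; simpl. rewrite IH, mono_eval_scale, Ht. ring.
Qed.

(** The function [h -> F ((1 + h) x)] is differentiated at 0 in two ways. *)
Lemma euler n m F D x : taylor n F D -> homogeneous_fun m F ->
  sumR n (fun i => D i x * x i) = INR m * F x.
Proof.
  intros HF Hm. pose proof (taylor_line n F D x x HF) as H.
  assert (Hpow : derivable_pt_lim (fun h => (1 + h) ^ m * F x) 0 (INR m * F x)).
  { replace (INR m * F x) with ((INR m * (1 + 0) ^ pred m * (0 + 1)) * F x + (1 + 0) ^ m * 0)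
      by (rewrite Rplus_0_r, !pow1; ring).
    apply (derivable_pt_lim_mult (fun h => (1 + h) ^ m) (fun _ => F x)).
    - apply (derivable_pt_lim_comp (fun h => 1 + h) (fun y => y ^ m)).
      + apply (derivable_pt_lim_plus (fun _ => 1) (fun h => h)).
        * apply derivable_pt_lim_const.
        * apply derivable_pt_lim_id.
      + apply derivable_pt_lim_pow.
    - apply derivable_pt_lim_const. }
  apply (uniqueness_limite _ 0 _ _ H).
  replace (fun h => F (fun i => x i + h * x i)) with (fun h => (1 + h) ^ m * F x); [exact Hpow|].
  apply functional_extensionality; intros h. rewrite <- Hm. f_equal.
  apply functional_extensionality; intros i. ring.
Qed.

(** Moving coordinate [j] of [r u] to [t] is [r] times moving that of [u] to [t / r]; the chain rule
    and uniqueness of derivatives conclude. *)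
Lemma gradient_scale n m F D r u j : taylor n F D -> homogeneous_fun m F ->
  0 < r -> (0 < m)%nat -> (j < n)%nat ->
  D j (fun i => r * u i) = r ^ (m - 1) * D j u.
Proof.
  intros HF Hm Hr Hm0 Hj.
  pose proof (taylor_gradient n F D (fun i => r * u i) HF j Hj) as H1. cbv beta in H1.
  pose proof (taylor_gradient n F D u HF j Hj) as H2. cbv beta in H2.
  apply (uniqueness_limite _ _ _ _ H1).
  replace (fun t => F (upd (fun i => r * u i) j t))
    with (fun t => r ^ m * F (upd u j (/ r * t))).
  - replace (r ^ (m - 1) * D j u) with (r ^ m * (D j u * (/ r * 1))).
    + apply (derivable_pt_lim_scal (fun t => F (upd u j (/ r * t)))).
      apply (derivable_pt_lim_comp (fun t => / r * t) (fun t => F (upd u j t))).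
      * apply (derivable_pt_lim_scal (fun t => t)). apply derivable_pt_lim_id.
      * replace (/ r * (r * u j)) with (u j) by (field; lra). exact H2.
    + replace m with (S (m - 1)) at 1 by lia. simpl. field; lra.
  - apply functional_extensionality; intros t. rewrite <- Hm. f_equal.
    apply functional_extensionality; intros i. unfold upd.
    destruct (Nat.eqb i j); [field; lra | reflexivity].
Qed.

Lemma euler_bound n m F D x : taylor n F D -> homogeneous_fun m F -> box n x ->
  INR m * F x <= INR n * sqrt (gradsq n D x).
Proof.
  intros HF Hm Hx. rewrite <- (euler n m F D x HF Hm).
  (* The increment from [x] to [2 x] is [x] itself, of l1 length at most [n] in the box. *)
  pose proof (gradsq_dist1 n D x (fun i => 2 * x i)) as H.
  rewrite (sumR_ext n _ (fun i => D i x * x i)) in H by (intros; ring).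
  apply Rle_trans with (1 := H). rewrite Rmult_comm.
  apply Rmult_le_compat_r; [apply sqrt_pos|].
  replace (INR n) with (INR n * 1) by ring.
  unfold dist1. rewrite <- sumR_const. apply sumR_le; intros i Hi.
  replace (2 * x i - x i) with (x i) by ring. apply Rabs_le. exact (Hx i Hi).
Qed.

(** * From the sphere to all points *)

Lemma sphere_box n x : norm n x = 1 -> box n x.
Proof.
  intros Hx i Hi. apply Rabs_le_bounds. rewrite <- sqrt_Rsqr_abs, Rsqr_pow2, <- Hx.
  apply sqrt_le_1_alt.
  apply (sumR_term_le n (fun i => x i ^ 2)); [intros; apply pow2_ge_0 | exact Hi].
Qed.

Lemma sumR_sq_sqrt n x : norm n x ^ 2 = sumR n (fun i => x i ^ 2).
Proof. apply pow2_sqrt, sumR_nonneg; intros; apply pow2_ge_0. Qed.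

Lemma norm_eq_1 n x : norm n x = 1 <-> sumR n (fun i => x i ^ 2) = 1.
Proof.
  rewrite <- sumR_sq_sqrt. split; [intros ->; ring|].
  intros H. assert (0 <= norm n x) by apply sqrt_pos. nra.
Qed.

Lemma lojasiewicz_sphere n m F D : (1 <= m)%nat ->
  polyfun F -> (forall i, polyfun (D i)) -> (forall i, depends_on n (D i)) ->
  taylor n F D -> homogeneous_fun m F -> (forall x, 0 <= F x) ->
  exists N c, (m <= N)%nat /\ (1 <= N)%nat /\ 0 < c /\
    forall x, norm n x = 1 -> c * F x ^ (2 * N - 1) <= gradsq n D x ^ N.
Proof.
  intros Hm1 HF HD dD HT Hm Hpos.
  set (n' := INR n + 1). assert (Hn' : 1 <= n') by (unfold n'; pose proof (pos_INR n); lra).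
  assert (Heuler : forall x, norm n x = 1 -> F x ^ 2 <= n' ^ 2 * gradsq n D x).
  { intros x Hx. pose proof (euler_bound n m F D x HT Hm (sphere_box n x Hx)) as H.
    pose proof (sqrt_pos (gradsq n D x)). apply le_INR in Hm1. simpl in Hm1.
    specialize (Hpos x).
    rewrite <- (pow2_sqrt (gradsq n D x)), <- Rpow_mult_distr by apply gradsq_nonneg.
    apply pow_incr. split; [exact Hpos|]. unfold n'. nra. }
  destruct (HT 1) as [C HC].
  destruct (lojasiewicz_semialg n F D C (fun x => norm n x = 1) m) as [N [del [HNm [HN1 [Hdel H]]]]].
  - exact HF.
  - exact HD.
  - apply (sa_ext (fun x => gradsq n (fun i y => y i) x = 1)).
    + intros x. symmetry. apply norm_eq_1.
    + apply sa_eq; [|apply pf_const]. apply pf_gradsq. intros; apply pf_var.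
  - now apply taylor_depends in HT.
  - intros x y Hxy. apply sumR_ext; intros i Hi. now rewrite (dD i x y Hxy).
  - intros x y Hxy. unfold norm.
    now rewrite (sumR_ext n (fun i => x i ^ 2) (fun i => y i ^ 2))
      by (intros i Hi; now rewrite Hxy).
  - intros x y Hx Hy.
    destruct (HC x y) as [_ [_ H]]; try (intros i Hi; apply Rabs_le; auto).
    apply Rabs_le_bounds in H. lra.
  - apply sphere_box.
  - exists (/ n' ^ 2). assert (Hn2 : 0 < n' ^ 2) by (apply pow_lt; lra).
    split; [now apply Rinv_0_lt_compat|]. intros x Hx _.
    apply Rmult_le_reg_l with (n' ^ 2); [exact Hn2|].
    rewrite <- Rmult_assoc, Rinv_r, Rmult_1_l by lra. now apply Heuler.
  - assert (H4 : 0 < 4 ^ N) by (apply pow_lt; lra).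
    assert (HnN : 0 < (n' ^ 2) ^ N) by (apply pow_lt, pow_lt; lra).
    (* The first bound undoes the factor 4 where [F x < del]; the second serves [F x >= del], where
       Euler's identity bounds [F x ^ (2 * N)] by [(n' ^ 2) ^ N * gradsq n D x ^ N]. *)
    set (c := Rmin (/ 4 ^ N) (del / (n' ^ 2) ^ N)).
    assert (Hc : 0 < c).
    { apply Rmin_glb_lt; [now apply Rinv_0_lt_compat | now apply Rdiv_lt_0_compat]. }
    assert (Hc1 : c * 4 ^ N <= 1).
    { rewrite <- (Rinv_l (4 ^ N)) by lra. apply Rmult_le_compat_r; [lra | apply Rmin_l]. }
    assert (Hc2 : c * (n' ^ 2) ^ N <= del).
    { replace del with (del / (n' ^ 2) ^ N * (n' ^ 2) ^ N) by (field; lra).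
      apply Rmult_le_compat_r; [lra | apply Rmin_r]. }
    exists N, c; split; [exact HNm|]; split; [exact HN1|]; split; [exact Hc|].
    intros x Hx. specialize (Hpos x).
    assert (HG : 0 <= gradsq n D x ^ N) by (apply pow_le, gradsq_nonneg).
    destruct (Req_dec (F x) 0) as [Hz|Hz].
    { rewrite Hz, pow_i by lia. lra. }
    assert (Hq : 0 < F x ^ (2 * N - 1)) by (apply pow_lt; lra).
    destruct (Rlt_le_dec (F x) del) as [Hlt|Hge].
    + specialize (H x Hx ltac:(lra)). rewrite Rpow_mult_distr in H.
      apply Rle_trans with (c * (4 ^ N * gradsq n D x ^ N)).
      * apply Rmult_le_compat_l; lra.
      * rewrite <- Rmult_assoc. nra.
    + assert (HE : F x * F x ^ (2 * N - 1) <= (n' ^ 2) ^ N * gradsq n D x ^ N).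
      { rewrite tech_pow_Rmult. replace (S (2 * N - 1)) with (2 * N)%nat by lia.
        rewrite pow_mult, <- Rpow_mult_distr. apply pow_incr.
        split; [apply pow2_ge_0 | now apply Heuler]. }
      apply Rmult_le_reg_l with ((n' ^ 2) ^ N); [exact HnN|].
      apply Rle_trans with (2 := HE). rewrite <- Rmult_assoc.
      apply Rmult_le_compat_r; lra.
Qed.

Lemma lojasiewicz_homogeneous n m F D N c : (1 <= m)%nat -> (m <= N)%nat ->
  taylor n F D -> homogeneous_fun m F ->
  (forall x, norm n x = 1 -> c * F x ^ (2 * N - 1) <= gradsq n D x ^ N) ->
  forall x, 0 < norm n x ->
    c * F x ^ (2 * N - 1) <= sqrt (gradsq n D x) ^ (2 * N) * norm n x ^ (2 * N - m).
Proof.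
  intros Hm1 HmN HT Hm Hsphere x Hx.
  rewrite pow_mult, pow2_sqrt by apply gradsq_nonneg.
  set (r := norm n x) in *. set (u := fun i => x i / r).
  assert (Hxu : x = fun i => r * u i).
  { apply functional_extensionality; intros i. unfold u; field; lra. }
  assert (Hu : norm n u = 1).
  { apply norm_eq_1.
    rewrite (sumR_ext n _ (fun i => / r ^ 2 * x i ^ 2)) by (intros; unfold u; field; lra).
    rewrite sumR_scal, <- sumR_sq_sqrt. fold r. field; lra. }
  assert (HG : gradsq n D x = (r ^ (m - 1)) ^ 2 * gradsq n D u).
  { unfold gradsq. rewrite <- sumR_scal. apply sumR_ext; intros i Hi.
    rewrite Hxu, (gradient_scale n m F D) by (assumption || lia). ring. }
  specialize (Hsphere u Hu).
  rewrite HG, Rpow_mult_distr.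
  assert (HFx : F x = r ^ m * F u) by (rewrite Hxu; apply Hm).
  rewrite HFx, Rpow_mult_distr.
  rewrite <- !pow_mult.
  replace (r ^ ((m - 1) * (2 * N)) * gradsq n D u ^ N * r ^ (2 * N - m))
    with (r ^ ((m - 1) * (2 * N)) * r ^ (2 * N - m) * gradsq n D u ^ N) by ring.
  rewrite <- pow_add.
  (* Both sides have the same degree in [r]; [m <= N] keeps the subtraction [2 * N - m] from
     truncating. *)
  replace ((m - 1) * (2 * N) + (2 * N - m))%nat with (m * (2 * N - 1))%nat by nia.
  replace (c * (r ^ (m * (2 * N - 1)) * F u ^ (2 * N - 1)))
    with (r ^ (m * (2 * N - 1)) * (c * F u ^ (2 * N - 1))) by ring.
  apply Rmult_le_compat_l; [apply pow_le; lra | exact Hsphere].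
Qed.

(** * Real powers and the final inequality *)

Lemma rpow_nonneg a b : 0 <= rpow a b.
Proof.
  unfold rpow. destruct (Req_EM_T a 0).
  - destruct (Req_EM_T b 0); lra.
  - apply Rlt_le, exp_pos.
Qed.

Lemma rpow_pos_base a b : 0 < a -> rpow a b = Rpower a b.
Proof. intros Ha. unfold rpow. destruct (Req_EM_T a 0); [lra | reflexivity]. Qed.

Lemma Rpower_root a k q : 0 < a -> 0 < q -> Rpower (a ^ k) (/ q) = Rpower a (INR k / q).
Proof.
  intros Ha Hq. rewrite <- Rpower_pow by exact Ha. rewrite Rpower_mult. reflexivity.
Qed.

Theorem theorem4 (n m : nat) (p : rpoly) :
  (1 <= n)%nat ->
  homogeneous_poly n m p ->
  (forall x : nat -> R, 0 <= poly_eval p x) ->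
  (1 < m)%nat ->
  exists eps C : R,
    0 < eps /\ eps <= 1 / (INR m - 1) /\ 0 < C /\
    forall x g : nat -> R,
      is_gradient n (poly_eval p) x g ->
      rpow (norm n g) (1 + eps) * rpow (norm n x) (1 - (INR m - 1) * eps)
        >= C * poly_eval p x.
Proof.
  intros _ Hp Hpos Hm1.
  assert (Hm := poly_eval_homogeneous n m p Hp).
  destruct (smooth_poly_eval n p) as [HF [D [HD [dD HT]]]].
  { eapply Forall_impl; [|exact Hp]. now intros t [H _]. }
  set (F := poly_eval p) in *.
  destruct (lojasiewicz_sphere n m F D ltac:(lia) HF HD dD HT Hm Hpos)
    as [N [c [HmN [HN1 [Hc Hsphere]]]]].
  assert (Hall := lojasiewicz_homogeneous n m F D N c ltac:(lia) HmN HT Hm Hsphere).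
  set (q := INR (2 * N - 1)).
  assert (Hq : q = 2 * INR N - 1).
  { unfold q. rewrite minus_INR by lia. rewrite mult_INR. simpl; ring. }
  assert (HmR : 2 <= INR m) by (apply (le_INR 2 m); lia).
  assert (HNR : INR m <= INR N) by now apply le_INR.
  assert (Hq0 : 0 < q) by lra.
  (* The polynomial inequality is raised to the power [1 / q], where [q = 2N - 1]: then
     [2N / q = 1 + eps] and [(2N - m) / q = 1 - (m - 1) eps]. The bound on [eps] is [m - 1 <= q]. *)
  exists (/ q), (Rpower c (/ q)).
  split; [now apply Rinv_0_lt_compat|].
  split; [unfold Rdiv; rewrite Rmult_1_l; apply Rinv_le_contravar; lra|].
  split; [apply exp_pos|].
  intros x g Hg. apply Rle_ge.
  assert (Hnorm : norm n g = sqrt (gradsq n D x)).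
  { unfold norm, gradsq. f_equal. apply sumR_ext; intros i Hi. f_equal.
    apply (is_gradient_unique n F x g (fun j => D j x)); [exact Hg | | exact Hi].
    now apply taylor_gradient. }
  (* Zeros of [F] are treated apart: otherwise [x] and the gradient are nonzero, and [rpow] is the
     ordinary power. *)
  destruct (Req_dec (F x) 0) as [Hz|Hz].
  { rewrite Hz, Rmult_0_r. apply Rmult_le_pos; apply rpow_nonneg. }
  assert (HFx : 0 < F x) by (specialize (Hpos x); lra).
  assert (Hr : 0 < norm n x).
  { destruct (Rle_lt_or_eq_dec 0 (norm n x) (sqrt_pos _)) as [H|H]; [exact H|].
    exfalso; apply Hz.
    assert (Hsum : sumR n (fun i => x i ^ 2) = 0) by (rewrite <- sumR_sq_sqrt, <- H; ring).
    (* If the norm vanishes, [x] agrees with [0 * x] on its first [n] coordinates, and [F] vanishes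
       there because [m > 0]. *)
    rewrite (taylor_depends n F D HT x (fun i => 0 * x i)).
    - rewrite Hm, pow_i by lia. ring.
    - intros i Hi. assert (Hi2 : x i ^ 2 <= 0).
      { rewrite <- Hsum. apply (sumR_term_le n (fun i => x i ^ 2)); [|exact Hi].
        intros; apply pow2_ge_0. }
      nra. }
  specialize (Hall x Hr). rewrite <- Hnorm in Hall.
  assert (HFq : 0 < c * F x ^ (2 * N - 1)) by (apply Rmult_lt_0_compat; [exact Hc | now apply pow_lt]).
  assert (Hg0 : 0 < norm n g).
  { destruct (Rle_lt_or_eq_dec 0 (norm n g) (sqrt_pos _)) as [H|H]; [exact H|].
    rewrite <- H, pow_i in Hall by lia. lra. }
  rewrite !rpow_pos_base by assumption.
  replace (1 + / q) with (INR (2 * N) / q).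
  2:{ rewrite mult_INR. simpl. rewrite Hq. field. lra. }
  replace (1 - (INR m - 1) * / q) with (INR (2 * N - m) / q).
  2:{ rewrite minus_INR, mult_INR by lia. simpl. rewrite Hq. field. lra. }
  rewrite <- !Rpower_root by assumption.
  rewrite Rpower_mult_distr by (apply pow_lt; assumption).
  replace (F x) with (Rpower (F x ^ (2 * N - 1)) (/ q)).
  2:{ rewrite Rpower_root by assumption. fold q. unfold Rdiv.
      rewrite Rinv_r by lra. now apply Rpower_1. }
  rewrite Rpower_mult_distr by (assumption || now apply pow_lt).
  apply Rle_Rpower_l; [apply Rlt_le, Rinv_0_lt_compat; exact Hq0|].
  split; assumption.
Qed.
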